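(* Let $p$ be an odd prime, let $G$ be a GGS-group over the $p$-adic tree, and let $\mathbf{e}=(e_1,\ldots,e_{p-1})$ be the defining vector of $G$. Then, for every $n\ge 2$, we have $$\log_p |G_n| = tp^{n-2}+1-\delta\,\frac{p^{n-2}-1}{p-1}-\varepsilon\,\frac{p^{n-2}-(n-2)p+n-3}{(p-1)^2},$$ where $t$ is the rank of the circulant matrix $C(\mathbf{e},0)$ over $\mathbb{F}_p$, $\delta=1$ if $\mathbf{e}$ is symmetric and $\delta=0$ otherwise, and $\varepsilon=1$ if $\mathbf{e}$ is constant and $\varepsilon=0$ otherwise.
   Context: Let $p$ be an odd prime and $X=\{1,\ldots,p\}$. The $p$-adic tree $\mathcal{T}$ is the rooted tree whose vertex set is the free monoid $X^*$, where the words $vx$ ($x\in X$) are the immediate descendants of $v$. In $\mathrm{Aut}\,\mathcal{T}$, the product $fg$ means first $f$, then $g$. $\mathrm{Stab}(n)$ is the subgroup of automorphisms fixing all words of length $n$. For $G\le \mathrm{Aut}\,\mathcal{T}$, $\mathrm{Stab}_G(n)=\mathrm{Stab}(n)\cap G$ and $G_n=G/\mathrm{Stab}_G(n)$ is the $n$th congruence quotient. The isomorphism $\psi:\mathrm{Stab}(1)\to \mathrm{Aut}\,\mathcal{T}\times\cdots\times\mathrm{Aut}\,\mathcal{T}$ ($p$ factors) sends $g$ to $(g_1,\ldots,g_p)$, where $g_i$ is the automorphism of $\mathcal{T}$ induced by restricting $g$ to the subtree hanging from the vertex $i$. Let $a$ be the rooted automorphism permuting rigidly the $p$ subtrees hanging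 from the root according to the cycle $(1\ 2\ \ldots\ p)$; $a$ has order $p$, so $a^k$ makes sense for $k\in\mathbb{F}_p$. Given a non-zero vector $\mathbf{e}=(e_1,\ldots,e_{p-1})\in\mathbb{F}_p^{p-1}$, let $b$ be defined recursively by $\psi(b)=(a^{e_1},\ldots,a^{e_{p-1}},b)$. The group $G=\langle a,b\rangle$ is the GGS-group with defining vector $\mathbf{e}$. For a vector $(a_1,\ldots,a_n)$, $C(a_1,\ldots,a_n)$ is the $n\times n$ circulant matrix with entries $c_{ij}=a_{j-i+1}$ (indices reduced modulo $n$ to lie between $1$ and $n$), and $C(\mathbf{e},0)$ denotes $C(e_1,\ldots,e_{p-1},0)$ over $\mathbb{F}_p$. The vector $\mathbf{e}$ is symmetric if $e_i=e_{p-i}$ for all $i=1,\ldots,p-1$, and constant if $e_1=\cdots=e_{p-1}$. *)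

(* Defs.v *)
From HB Require Import structures.
From mathcomp Require Import all_boot all_order all_algebra.
From mathcomp Require Import boolp classical_sets functions cardinality.
From mathcomp Require Import reals exp.

Set Implicit Arguments.
Unset Strict Implicit.
Unset Printing Implicit Defensive.

Local Open Scope classical_set_scope.

Section Groups.
Context {gT : groupType}.
Local Open Scope group_scope.

(* The subgroup generated by A: the intersection of all subgroups containing A *)
Definition generated (A : set gT) : set gT :=
  smallest (fun H : set gT => group_closed (mem H)) A.

Definition quotient_set (G H : set gT) : set (set gT) :=
  [set [set g * h | h in H] | g in G].

End Groups.

(* The alphabet {1, ..., p} is 'I_p, the letter i + 1 being the ordinal i. *)
Definition word (p : nat) := seq 'I_p.

Definition child p (v w : word p) : Prop := exists x, w = rcons v x.

(* Preservation of [child] in both directions forces the root to be fixed,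
   see [aut_root]. *)
Record tree_aut (p : nat) := TreeAut {
  aut_fun :> word p -> word p;
  aut_inv : word p -> word p;
  aut_funK : cancel aut_fun aut_inv;
  aut_invK : cancel aut_inv aut_fun;
  aut_child : forall v w, child v w <-> child (aut_fun v) (aut_fun w) }.

Lemma tree_autP p (f g : tree_aut p) : (forall w, f w = g w) -> f = g.
Proof.
case: f g => [f f' fK f'K cf] [g g' gK g'K cg] /= fg.
have /funext efg := fg; subst g.
have /funext ef' : forall w, f' w = g' w by move=> w; rewrite -{1}(g'K w) fK.
subst g'; congr TreeAut; exact: Prop_irrelevance.
Qed.

Lemma aut_root p (f : tree_aut p) : f [::] = [::].
Proof.
case/lastP E: (f [::]) => [//|s x].
have : child (f (aut_inv f s)) (f [::]) by exists x; rewrite E aut_invK.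
by rewrite -aut_child => -[y]; case: (aut_inv f s).
Qed.

Section TreeAutGroup.
Variable p : nat.

Lemma child_iff_of_cancel (f g : word p -> word p) : cancel f g ->
    (forall v x, child (f v) (f (rcons v x))) ->
    (forall v x, child (g v) (g (rcons v x))) ->
  forall v w, child v w <-> child (f v) (f w).
Proof.
move=> fK cf cg v w; split=> [[x ->]|[x fw]]; first exact: cf.
by rewrite -(fK w) fw -{1}(fK v); exact: cg.
Qed.

Definition aut_one : tree_aut p :=
  @TreeAut p id id (fun=> erefl) (fun=> erefl) (fun v w => iff_refl (child v w)).

Lemma aut_inv_child (f : tree_aut p) v w :
  child v w <-> child (aut_inv f v) (aut_inv f w).
Proof. by rewrite (aut_child f (aut_inv f v)) !aut_invK. Qed.

Definition aut_invg (f : tree_aut p) : tree_aut p :=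
  TreeAut (aut_invK f) (aut_funK f) (aut_inv_child f).

Lemma aut_mul_child (f g : tree_aut p) v w :
  child v w <-> child ((g \o f) v) ((g \o f) w).
Proof. by rewrite -!aut_child. Qed.

(* The product fg is f followed by g. *)
Definition aut_mul (f g : tree_aut p) : tree_aut p :=
  TreeAut (can_comp (aut_funK g) (aut_funK f))
          (can_comp (aut_invK f) (aut_invK g)) (aut_mul_child f g).

HB.instance Definition _ := gen_eqMixin (tree_aut p).
HB.instance Definition _ := gen_choiceMixin (tree_aut p).

Lemma aut_mulA : associative aut_mul.
Proof. by move=> f g h; apply: tree_autP. Qed.
Lemma aut_mul1g : left_id aut_one aut_mul.
Proof. by move=> f; apply: tree_autP. Qed.
Lemma aut_mulg1 : right_id aut_one aut_mul.
Proof. by move=> f; apply: tree_autP. Qed.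
Lemma aut_mulVg : left_inverse aut_one aut_invg aut_mul.
Proof. by move=> f; apply: tree_autP => w /=; rewrite aut_invK. Qed.
Lemma aut_mulgV : right_inverse aut_one aut_invg aut_mul.
Proof. by move=> f; apply: tree_autP => w /=; rewrite aut_funK. Qed.

HB.instance Definition _ := isGroup.Build (tree_aut p)
  aut_mulA aut_mul1g aut_mulg1 aut_mulVg aut_mulgV.

Definition Stab (n : nat) : set (tree_aut p) :=
  [set g | forall w : word p, size w = n -> g w = w].

(* G_n = G / Stab_G(n), as a set of cosets *)
Definition congruence_quotient (G : set (tree_aut p)) (n : nat) :=
  quotient_set G (Stab n `&` G).

Definition rooted_fun (s : 'I_p -> 'I_p) (w : word p) : word p :=
  if w is i :: v then s i :: v else [::].

Lemma rooted_child s v x :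
  child (rooted_fun s v) (rooted_fun s (rcons v x)).
Proof. by case: v => [|i v] /=; [exists (s x) | exists x]. Qed.

Lemma rooted_funK (s s' : 'I_p -> 'I_p) :
  cancel s s' -> cancel (rooted_fun s) (rooted_fun s').
Proof. by move=> sK [|i v] //=; rewrite sK. Qed.

(* [ordS i] is i + 1 mod p, i.e. the cycle (1 2 ... p). *)
Definition ggs_a : tree_aut p :=
  let K := rooted_funK (@ordSK p) in
  TreeAut K (rooted_funK (@ord_predK p))
    (child_iff_of_cancel K (@rooted_child _) (@rooted_child _)).

(* Fixes the first level, acts as s_1, ..., s_(p-1) on the first p - 1 subtrees
   and recursively as itself on the last one: [insub] is [None] exactly at the
   last letter. *)
Fixpoint directed_fun (s : 'I_p.-1 -> tree_aut p) (w : word p) : word p :=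
  if w is i :: v then
    i :: (if insub (i : nat) is Some j then s j v else directed_fun s v)
  else [::].

Lemma directed_child s v x :
  child (directed_fun s v) (directed_fun s (rcons v x)).
Proof.
elim: v => [|i v [y IHv]] /=.
  by exists x; case: insubP => [j _ _|_] //=; rewrite aut_root.
case: insubP => [j _ _|_]; last by exists y; rewrite IHv.
have [y' ->] : child (s j v) (s j (rcons v x)) by rewrite -aut_child; exists x.
by exists y'.
Qed.

Lemma directed_funK (s s' : 'I_p.-1 -> tree_aut p) :
    (forall j, cancel (s j) (s' j)) ->
  cancel (directed_fun s) (directed_fun s').
Proof.
move=> sK; elim=> //= i v IHv; congr cons.
by case: insubP => [j _ _|_] //; rewrite sK.
Qed.

Definition directed (s : 'I_p.-1 -> tree_aut p) : tree_aut p :=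
  let s' := aut_invg \o s in
  let K := @directed_funK s s' (fun j => aut_funK (s j)) in
  let K' := @directed_funK s' s (fun j => aut_invK (s j)) in
  TreeAut K K'
    (child_iff_of_cancel K (@directed_child s) (@directed_child s')).

(* e_(j+1) is [e 0 j], and its exponent is its representative in [0, p). *)
Definition ggs_b (e : 'rV['F_p]_p.-1) : tree_aut p :=
  directed (fun j => (ggs_a ^+ (e 0%R j : nat))%g).

(* psi(g) = (h_1, ..., h_p) *)
Definition psi_spec (g : tree_aut p) (h : 'I_p -> tree_aut p) : Prop :=
  Stab 1 g /\ forall i v, g (i :: v) = i :: h i v.

Lemma ggs_b_psi (e : 'rV['F_p]_p.-1) :
  psi_spec (ggs_b e) (fun i => if insub (i : nat) is Some j
                               then (ggs_a ^+ (e 0%R j : nat))%g else ggs_b e).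
Proof.
split=> [|i v] /=; last by case: insubP.
case=> [//|i [|//]] _ /=; congr (_ :: _).
by case: insubP => //= *; rewrite aut_root.
Qed.

Lemma ggs_b_unique (e : 'rV['F_p]_p.-1) b :
  psi_spec b (fun i => if insub (i : nat) is Some j
                       then (ggs_a ^+ (e 0%R j : nat))%g else b) ->
  b = ggs_b e.
Proof.
move=> [_ bE]; apply: tree_autP; elim=> [|i v IHv]; first by rewrite !aut_root.
rewrite bE /=.
by case: insubP => //= _; rewrite IHv.
Qed.

Definition GGS (e : 'rV['F_p]_p.-1) : set (tree_aut p) :=
  generated [set ggs_a; ggs_b e].

End TreeAutGroup.

Section Vectors.
Local Open Scope ring_scope.

(* In 'I_n.+1, [j - i] is subtraction modulo n + 1. *)
Definition circulant (R : Type) n (v : 'rV[R]_n.+1) : 'M[R]_n.+1 :=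
  \matrix_(i, j) v 0 (j - i).

(* (v, 0) *)
Definition append0 (R : nmodType) n (v : 'rV[R]_n) : 'rV[R]_n.+1 :=
  \row_k (if unlift ord_max k is Some j then v 0 j else 0).

(* With indices starting at 0, i |-> p - i on {1, ..., p-1} becomes [rev_ord]. *)
Definition symmetric_vec (R : eqType) n (v : 'rV[R]_n) : bool :=
  [forall i, v 0 i == v 0 (rev_ord i)].

Definition constant_vec (R : eqType) n (v : 'rV[R]_n) : bool :=
  [forall i, forall j, v 0 i == v 0 j].

Definition log (R : realType) (b x : R) : R := ln x / ln b.

End Vectors.

(* Main.v *)
Require Import Defs.
From HB Require Import structures.
From mathcomp Require Import all_boot all_order all_algebra.
From mathcomp Require Import all_fingroup all_solvable all_field mxabelem ring.
From mathcomp Require finmap boolp classical_sets functions cardinality.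
From mathcomp Require reals exp.

Set Implicit Arguments.
Unset Strict Implicit.
Unset Printing Implicit Defensive.

Import GRing.Theory GroupScope.

(** Write G_n for the n-th congruence quotient, seen as the permutation group
    generated by the actions of a and b on the words of length n, and put
    m = n - 1.  The normal closure of b in G_n fixes the first letter of every
    word, hence it is a subgroup T of the direct power of p copies of G_m; it is
    generated by the p tuples [psi_b i] that have b in coordinate i and
    a ^ e_(k - i) in every other coordinate k.  Since a permutes these generators
    cyclically, |G_n| = p |T| ([card_wreath]), and everything rests on
    determining T from G_m.  For m = 1 the element b is trivial and T is the row
    space of the circulant matrix, so that |G_2| = p^(t+1)
    ([card_psi_stab_first]).  For m >= 2 the p-group G_m is not abelian, whence
    |G_m : G_m'| = p^2 ([index_der1_gen2]); the three cases of the theorem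
    correspond to three descriptions of T.

    If e is not symmetric, T contains the power of G_m' and T over that power is
    elementary abelian of rank p.  Only the inclusion needs an argument
    ([asym_der1]): the commutators of the generators show that it holds up to the
    power of the next term of the lower central series, and since T projects onto
    each factor this approximation propagates down the series ([lcn_lift]).  Thus
    |T| = p^p |G_m'|^p.

    If e is symmetric but not constant, T contains only the power of the third
    term L_3 of the lower central series of G_m ([sym_lcn3]).  The commutator of
    two generators is x in one coordinate and x^-1 in another, and T meets the
    power of G_m' in the tuples whose coordinates multiply to an element of L_3
    (the group [antidiag]); this costs one more factor p
    ([card_psi_stab_sym]).

    If e is constant, one may take e_i = 1.  Let K_m be the subgroup of G_m
    generated by the conjugates of y = b a^-1 under the powers of a.  Then T
    contains the tuples of elements of K_m whose coordinates multiply to an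
    element of K_m', with index p.  Here the index of K_m' in K_m depends on m:
    K_n modulo K_n' is the extension, by the cyclic group generated by the new y,
    of the coinvariants of y on an abelian group, and coinvariants are as many as
    invariants ([card_coinvariants]).  The invariants turn out to be a copy of
    K_m modulo K_m', so the index is multiplied by p at each level
    ([index_kerW]) and equals p^m.  This linear growth is the source of the last
    term of the formula.

    Each case yields a first-order recurrence for log_p |G_n|, and solving it
    gives the stated closed form. *)

(** * Two-generated finite groups *)

Section TwoGenerated.
Variable gT : finGroupType.
Implicit Types (G H N : {group gT}) (a b c x y : gT).

Lemma der1_gen_sub (X : {set gT}) N :
    X \subset 'N(N) -> {in X &, forall x y, [~ x, y] \in N} ->
  <<X>>^`(1) \subset N.
Proof.
move=> nNX XN; apply: der1_min; first by rewrite gen_subG.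
rewrite quotient_gen // abelian_gen /abelian quotient_cents2r // gen_subG.
by apply/subsetP=> _ /imset2P[x y Xx Xy ->]; apply: XN.
Qed.

Lemma der1_gen2_sub a b N :
  a \in 'N(N) -> b \in 'N(N) -> [~ a, b] \in N ->
  <<[set a; b]>>^`(1) \subset N.
Proof.
move=> nNa nNb Nab; apply: der1_gen_sub.
  by apply/subsetP=> x /set2P[]->.
by move=> x y /set2P[]-> /set2P[]->; rewrite ?commgg ?group1 // -invg_comm groupV.
Qed.

(** The quotient is a nontrivial subgroup of a cyclic group of order dividing p.
    Used for every index p that occurs below. *)
Lemma index_join_cycle G N c p :
    prime p -> N \subset G -> c \in 'N(N) -> G \subset N <*> <[c]> ->
    c ^+ p \in N -> G :!=: N -> #|G : N| = p.
Proof.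
move=> p_pr sNG nNc sG Ncp neGN.
have nNc' : <[c]> \subset 'N(N) by rewrite cycle_subG.
have sGN : G \subset 'N(N).
  by apply: subset_trans sG _; rewrite join_subG normG.
have sGc : G / N \subset <[coset N c]>.
  rewrite -quotient_cycle // -(quotientYidl nNc').
  exact: quotientS.
have dv : #|G / N| %| p.
  apply: (dvdn_trans (cardSg sGc)); rewrite -orderE order_dvdn.
  by rewrite -morphX //= coset_id.
rewrite -card_quotient //.
move/primeP: p_pr => [_ /(_ _ dv)/orP[|/eqP//]].
rewrite -trivg_card1 -subG1 quotient_sub1 // => sGN'.
by case/eqP: neGN; apply/eqP; rewrite eqEsubset sGN'.
Qed.

(** A nilpotent group with cyclic abelianization is cyclic, so a single element
    never generates a non-abelian nilpotent group modulo its derived subgroup.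
    *)
Lemma nonabelian_join_cycle_der1 G x :
    nilpotent G -> ~~ abelian G -> x \in G -> G^`(1) <*> <[x]> != G.
Proof.
move=> nilG nabG Gx; apply: contraNneq nabG => eG.
apply: cyclic_abelian; apply: cyclic_nilpotent_quo_der1_cyclic => //.
have nx : <[x]> \subset 'N(G^`(1)) by rewrite cycle_subG (subsetP (der_norm 1 G)).
have -> : G / G^`(1) = <[x]> / G^`(1) by rewrite -(quotientYidl nx) /= eG.
by rewrite quotient_cycle ?cycle_cyclic // (subsetP (der_norm 1 G)).
Qed.

(** On the finite abelian group L / N, the map l |-> [l, y] is an endomorphism;
    its image is the derived subgroup of L<y> modulo N and its kernel is the
    group of invariants of y. This is the equality of the numbers of invariants
    and of coinvariants of a cyclic action. *)
Lemma card_coinvariants (L N : {group gT}) y (C : {set gT}) :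
    N \subset L -> L \subset 'N(N) -> abelian (L / N) ->
    y \in 'N(L) -> y \in 'N(N) -> N \subset (L <*> <[y]>)^`(1) ->
    (forall l, (l \in C) = (l \in L) && ([~ l, y] \in N)) ->
  (#|(L <*> <[y]>)^`(1)| * #|C| = #|L| * #|N|)%N.
Proof.
move=> sNL nNL abL nLy nNy sNK memC; set K := (L <*> <[y]>)%G.
have Ly l : l \in L -> [~ l, y] \in L.
  by move=> Ll; rewrite groupM ?groupV // memJ_norm.
have Ky : y \in K by rewrite -cycle_subG joing_subr.
have sLK : L \subset K by exact: joing_subl.
pose phi l := coset N [~ l, y].
have phiM : {in L &, {morph phi : l m / l * m}}.
  move=> l m Ll Lm; rewrite /phi commMgJ morphM /=; last 2 first.
  - by rewrite (subsetP nNL) // groupJ // Ly.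
  - by rewrite (subsetP nNL) // Ly.
  congr (_ * _); rewrite morphJ ?(subsetP nNL) ?Ly //.
  by rewrite conjgE (centsP abL (coset N [~ l, y])) ?mulKg // mem_quotient // Ly.
pose f := Morphism phiM.
have kerC : 'ker f = C :> {set gT}.
  apply/setP=> l; rewrite memC; apply/idP/andP => [kl|[Ll Nl]].
    have Ll := dom_ker kl; split=> //.
    by apply: coset_idr; [rewrite (subsetP nNL) // Ly | exact: (mker kl)].
  by apply/kerP => //=; apply: coset_id.
have nNK : K \subset 'N(N) by rewrite join_subG nNL cycle_subG.
have sKN : K^`(1) \subset 'N(N) := subset_trans (der_sub 1 K) nNK.
have imK : f @* L = K^`(1) / N.
  apply/eqP; rewrite eqEsubset; apply/andP; split.
    apply/subsetP=> _ /morphimP[l _ Ll ->]; rewrite mem_quotient //.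
    by rewrite mem_commg // (subsetP sLK).
  rewrite sub_quotient_pre //.
  have fL : f @* L \subset L / N.
    by apply/subsetP=> _ /morphimP[l _ Ll ->]; rewrite mem_quotient // Ly.
  have eK : (K : {set gT}) = <<L :|: [set y]>>.
    by rewrite /K /= -[<[y]>]/<<[set y]>> joing_idr.
  rewrite eK; apply: der1_gen_sub.
    rewrite subUset sub1set; apply/andP; split.
      apply: subset_trans _ (morphpre_norm _ _).
      rewrite -sub_quotient_pre // sub_abelian_norm //.
    apply: (subsetP (morphpre_norm _ _)); rewrite mem_morphpre //= inE.
    apply/subsetP=> _ /imsetP[_ /morphimP[l _ Ll ->] ->].
    have Lly : l ^ y \in L by rewrite memJ_norm.
    suff -> : f l ^ coset N y = f (l ^ y) by rewrite mem_morphim.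
    change (phi l ^ coset N y = phi (l ^ y)).
    have yy : y ^ y = y by rewrite conjgE mulKg.
    rewrite /phi; have -> : [~ l ^ y, y] = [~ l, y] ^ y by rewrite conjRg yy.
    by rewrite morphJ // (subsetP nNL) ?Ly.
  move=> u v /setUP[Lu|/set1P->] /setUP[Lv|/set1P->].
  - have sNR : N \subset coset N @*^-1 (f @* L) by exact: sub_cosetpre.
    apply: (subsetP sNR).
    by apply: (subsetP (der1_min nNL abL)); rewrite mem_commg.
  - by rewrite mem_morphpre ?(subsetP nNL) ?Ly // (mem_morphim f).
  - rewrite -invg_comm groupV.
    by rewrite mem_morphpre ?(subsetP nNL) ?Ly // (mem_morphim f).
  - by rewrite commgg group1.
have sCL : C \subset L by apply/subsetP=> l; rewrite memC => /andP[].
have iL : (#|C| * #|f @* L| = #|L|)%N.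
  by rewrite card_morphim setIid -kerC Lagrange //; apply/subsetP=> l /dom_ker.
have sNK' : N \subset K^`(1) by [].
by rewrite -(Lagrange sNK') -card_quotient // -imK mulnAC -mulnA iL mulnC.
Qed.

Variables (p : nat) (a b : gT).
Hypotheses (p_pr : prime p) (ap : a ^+ p = 1) (bp : b ^+ p = 1).
Let G := <<[set a; b]>>%G.
Hypotheses (nilG : nilpotent G) (nabG : ~~ abelian G).

Lemma gen2_l : a \in G. Proof. by rewrite mem_gen // set21. Qed.
Lemma gen2_r : b \in G. Proof. by rewrite mem_gen // set22. Qed.

Lemma der1_join_gen2 : G :=: G^`(1) <*> <[a]> <*> <[b]>.
Proof.
apply/eqP; rewrite eqEsubset gen_subG; apply/andP; split.
  apply/subsetP=> x /set2P[]->.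
    by rewrite -cycle_subG (subset_trans (joing_subr (G^`(1)) _)) ?joing_subl.
  by rewrite -cycle_subG joing_subr.
by rewrite !join_subG der_sub !cycle_subG gen2_l gen2_r.
Qed.

Lemma index_der1_joinl : #|G : G^`(1) <*> <[a]>| = p.
Proof.
have sN : G^`(1) <*> <[a]> \subset G by rewrite join_subG der_sub cycle_subG gen2_l.
have nN : G \subset 'N(G^`(1) <*> <[a]>) by rewrite sub_der1_norm // joing_subl.
apply: (index_join_cycle (c := b)) => //.
- by rewrite (subsetP nN) // gen2_r.
- by rewrite {1}der1_join_gen2.
- by rewrite bp group1.
- by rewrite eq_sym nonabelian_join_cycle_der1 // gen2_l.
Qed.

Lemma index_der1_gen2 : #|G : G^`(1)| = (p ^ 2)%N.
Proof.
have sN : G^`(1) <*> <[a]> \subset G by rewrite join_subG der_sub cycle_subG gen2_l.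
rewrite -(Lagrange_index sN) ?joing_subl // index_der1_joinl.
rewrite (index_join_cycle (c := a) p_pr) ?mulnn ?joing_subl //.
- by rewrite (subsetP (der_norm 1 G)) // gen2_l.
- by rewrite ap group1.
apply: contra (nonabelian_join_cycle_der1 nilG nabG gen2_r) => /eqP e.
by rewrite {2}der1_join_gen2 e.
Qed.

(** Every subgroup between L_3(G) and G' is normal, so [a, b] and L_3(G)
    together exhaust G'. *)
Lemma der1_sub_lcn3 N : 'L_3(G) \subset N -> [~ a, b] \in N -> G^`(1) \subset N.
Proof.
move=> sLN Nz; have sLG : 'L_3(G) \subset G^`(1) by exact: (lcn_sub_leq G (isT : 2 <= 3)).
pose N' := (N :&: G^`(1))%G.
have nN : G \subset 'N(N').
  rewrite -commg_subr commGC (subset_trans (commSg _ (subsetIr N _))) //.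
  by rewrite -[[~: _, _]]/('L_3(G)) subsetI sLN.
apply: subset_trans (subsetIl N G^`(1)).
apply: (@der1_gen2_sub a b N'); rewrite ?(subsetP nN) ?gen2_l ?gen2_r //.
by rewrite inE Nz mem_commg ?gen2_l ?gen2_r.
Qed.

(** If the commutator of the two generators is central modulo N, then G / N has
    class at most 2. *)
Lemma lcn3_gen2_sub N : G \subset 'N(N) ->
  (forall g, g \in G -> [~ [~ a, b], g] \in N) -> 'L_3(G) \subset N.
Proof.
move=> nN zN; have Gz : [~ a, b] \in G by rewrite groupR ?gen2_l ?gen2_r.
pose M := (coset_morphism N @*^-1 'C(G / N))%G.
have nM x : x \in G -> x \in 'N(M).
  move=> Gx; apply: (subsetP (morphpre_norm _ _)).
  rewrite mem_morphpre ?(subsetP nN) //.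
  by rewrite (subsetP (norms_cent (normG _))) // mem_quotient.
have sM : G^`(1) \subset M.
  apply: der1_gen2_sub; rewrite ?nM ?gen2_l ?gen2_r //.
  apply/morphpreP; split; first exact: (subsetP nN).
  apply/centP=> _ /morphimP[g ng Gg ->]; apply/commgP.
  by rewrite -morphR ?(subsetP nN) //= coset_id // zN.
have nG'N := subset_trans (der_sub 1 G) nN.
by rewrite lcnSn -quotient_cents2 //= sub_quotient_pre.
Qed.

(** Modulo L_3(G) the commutator is bilinear. *)
Lemma commX_lcn3 n : exists2 l, l \in 'L_3(G) & [~ a ^+ n, b] = [~ a, b] ^+ n * l.
Proof.
have La : a \in 'N('L_3(G)) by rewrite (subsetP (lcn_norm 3 G)) // gen2_l.
have Lb : b \in 'N('L_3(G)) by rewrite (subsetP (lcn_norm 3 G)) // gen2_r.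
have Gz : [~ a, b] \in G^`(1) by rewrite mem_commg // ?gen2_l // gen2_r.
have Lz : [~ a, b] \in 'N('L_3(G)) by rewrite groupR.
exists (([~ a, b] ^+ n)^-1 * [~ a ^+ n, b]); last by rewrite mulKVg.
apply: coset_idr; first by rewrite groupM ?groupV ?groupX // groupR ?groupX.
rewrite morphM ?groupV ?groupR ?groupX // morphV ?groupX // morphX //.
rewrite [X in _ * X]morphR ?groupX // morphX // commXg ?morphR ?mulVg //.
apply/commgP; rewrite -!morphR //= coset_id // -invg_comm groupV.
by rewrite mem_commg ?gen2_l.
Qed.

(** G' / L_3(G) is cyclic generated by [a, b], whose order divides that of a; it
    is not trivial because a nilpotent group with G' = L_3(G) is abelian. *)
Lemma index_lcn3_gen2 : #|G^`(1) : 'L_3(G)| = p.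
Proof.
have Gz : [~ a, b] \in G^`(1) by rewrite mem_commg // ?gen2_l // gen2_r.
have sLG : 'L_3(G) \subset G^`(1) by exact: (lcn_sub_leq G (isT : 2 <= 3)).
have nLz : [~ a, b] \in 'N('L_3(G)).
  by rewrite (subsetP (lcn_norm 3 G)) // (subsetP (der_sub 1 G)).
apply: (@index_join_cycle (G^`(1))%G 'L_3(G)%G [~ a, b] p) => //.
- apply: (@der1_sub_lcn3 ('L_3(G) <*> <[ [~ a, b]]>)%G); first exact: joing_subl.
  by rewrite -cycle_subG joing_subr.
- have [l Ll] := commX_lcn3 p.
  by rewrite ap comm1g => /esym/(canRL (mulgK _))->; rewrite mul1g groupV.
apply: contraNneq nabG => /= e.
have G'1 : G^`(1) = 1.
  have [//|nt] := eqVneq G^`(1) 1.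
  have nG : G \subset 'N_G(G^`(1)) by rewrite subsetI subxx der_norm.
  have := nil_comm_properl nilG (der_sub 1 G) nt nG.
  by rewrite -[[~: _, _]]/('L_3(G)) -e properxx.
by apply/commG1P.
Qed.

End TwoGenerated.

(** * Cartesian powers of a finite group *)

Section Power.
Variables (I : finType) (gT : finGroupType).
Notation gTI := {dffun forall i : I, (fun=> gT) i}.
Implicit Types (M N G : {group gT}) (T : {group gTI}) (f g : gTI) (i j k : I) (x y : gT).

Definition emb i x : gTI := dfung1 (gT := fun=> gT) (i := i) x.
Definition pow (A : {set gT}) : {set gTI} := setXn (fun=> A).
Canonical pow_group M : {group gTI} := Group (@group_setXn I (fun=> gT) (fun=> M)).

Lemma embE i x j : emb i x j = if j == i then x else 1.
Proof.
by rewrite /emb; case: eqVneq => [->|ne]; rewrite ?dfung1_id // dfung1_dflt // eq_sym.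
Qed.

Lemma embM i : {morph emb i : x y / x * y}.
Proof. exact: dfung1_morphM. Qed.

Canonical emb_morphism i := @Morphism _ _ setT (emb i) (in2W (@embM i)).

Lemma emb1 i : emb i 1 = 1.
Proof. by apply/ffunP=> j; rewrite embE ffunE if_same. Qed.
Lemma embV i x : emb i x^-1 = (emb i x)^-1.
Proof. by apply/ffunP=> j; rewrite !(ffunE, embE); case: eqP; rewrite ?invg1. Qed.
Lemma embX i x n : emb i (x ^+ n) = emb i x ^+ n.
Proof. by elim: n => [|n IHn]; rewrite ?emb1 // !expgS embM IHn. Qed.
Lemma embJ i x f : emb i x ^ f = emb i (x ^ f i).
Proof.
apply/ffunP=> j; rewrite !(ffunE, embE) conjgE.
by case: eqP => [->|] //=; rewrite mul1g mulVg.
Qed.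
Lemma emb_commute i j x y : i != j -> commute (emb i x) (emb j y).
Proof.
move=> ne; apply/ffunP=> k; rewrite !(ffunE, embE).
by case: eqP => [->|]; rewrite ?(negPf ne) ?mul1g ?mulg1.
Qed.
Lemma ffunX f n i : (f ^+ n) i = f i ^+ n.
Proof. by elim: n => [|n IHn]; rewrite ?ffunE // !expgS ffunE IHn. Qed.
Lemma ffunJ f g i : (f ^ g) i = f i ^ g i.
Proof. by rewrite !ffunE. Qed.
Lemma ffunR f g i : [~ f, g] i = [~ f i, g i].
Proof. by rewrite !ffunE. Qed.

Lemma powP (A : {set gT}) f : reflect (forall i, f i \in A) (f \in pow A).
Proof. exact: setXnP. Qed.

Lemma mem_emb M i x : (emb i x \in pow M) = (x \in M).
Proof.
apply/powP/idP => [/(_ i)|Mx j]; rewrite embE ?eqxx //.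
by case: eqP.
Qed.

Lemma powS (A B : {set gT}) : A \subset B -> pow A \subset pow B.
Proof. by move=> /subsetP sAB; apply/subsetP=> f /powP fA; apply/powP=> i; apply: sAB. Qed.

Lemma card_pow (A : {set gT}) : #|pow A| = (#|A| ^ #|I|)%N.
Proof. by rewrite cardsXn prod_nat_const. Qed.

Lemma pow_norm M (g : gTI) : (forall i, g i \in 'N(M)) -> g \in 'N(pow M).
Proof.
move=> nMg; rewrite inE; apply/subsetP=> _ /imsetP[f /powP Mf ->].
by apply/powP=> i; rewrite ffunJ memJ_norm.
Qed.

Lemma pow_sub M T : (forall i x, x \in M -> emb i x \in T) -> pow M \subset T.
Proof.
move=> sT; apply/subsetP=> f /powP Mf.
have : f \in \prod_i set1gXn (gT := fun=> gT) (i := i) M.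
  by rewrite (@setXn_prod I (fun=> gT) (fun=> M)); apply/powP.
case/prodsgP=> h hM ->; apply: group_prod => i _.
by have /set1gXnP[x Mx ->] := hM i isT; apply: sT.
Qed.

(** For M / N abelian, this is the group of the tuples in M whose product is
    trivial in M / N, see [in_antidiag]. It is defined by generators because its
    inclusion in the groups of interest is proved on generators. *)
Definition antidiag (M N : {set gT}) : {set gTI} :=
  <<pow N :|: \bigcup_i \bigcup_j [set emb i x * emb j x^-1 | x in M]>>.
Canonical antidiag_group M N := Eval hnf in [group of antidiag M N].

Lemma mem_antidiag M N i j x : x \in M -> emb i x * emb j x^-1 \in antidiag M N.
Proof.
move=> Mx; rewrite mem_gen // inE; apply/orP; right.
by apply/bigcupP; exists i => //; apply/bigcupP; exists j => //; apply/imsetP; exists x.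
Qed.

Lemma pow_antidiag M N : pow N \subset antidiag M N.
Proof. by rewrite sub_gen // subsetUl. Qed.

Lemma antidiag_sub M N T :
    pow N \subset T ->
    (forall i j x, i != j -> x \in M -> emb i x * emb j x^-1 \in T) ->
  antidiag M N \subset T.
Proof.
move=> NT MT; rewrite gen_subG subUset NT; apply/bigcupsP=> i _; apply/bigcupsP=> j _.
apply/subsetP=> _ /imsetP[x Mx ->]; have [->|/MT->//] := eqVneq i j.
by rewrite -embM mulgV emb1.
Qed.

Lemma antidiag_sub_pow M N : N \subset M -> antidiag M N \subset pow M.
Proof.
move=> sNM; apply: antidiag_sub; first exact: powS.
by move=> i j x _ Mx; rewrite groupM ?mem_emb ?groupV.
Qed.

(** The hypothesis says that all coordinates of g induce the same automorphism
    of M / N. *)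
Lemma antidiag_norm M N g :
    (forall i, g i \in 'N(M)) -> (forall i, g i \in 'N(N)) ->
    (forall i j x, x \in M -> x ^ g i * (x ^ g j)^-1 \in N) ->
  g \in 'N(antidiag M N).
Proof.
move=> nM nN cN; rewrite inE sub_conjg.
apply: (@antidiag_sub M N (antidiag M N :^ g^-1)%G).
  apply/subsetP=> f Nf; rewrite mem_conjgV (subsetP (pow_antidiag M N)) //.
  by rewrite memJ_norm // pow_norm.
move=> i j x _ Mx; rewrite mem_conjgV conjMg !embJ.
rewrite -[emb i _](mulgKV (emb j (x ^ g i))) -mulgA -embM conjVg groupM //.
  by rewrite -embV mem_antidiag // memJ_norm.
by rewrite (subsetP (pow_antidiag M N)) // mem_emb cN.
Qed.

Section Quotient.
Variables (M N : {group gT}).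
Hypotheses (sNM : N \subset M) (nNM : M \subset 'N(N)) (abMN : abelian (M / N)).

Definition coset_prod f := \prod_i coset N (f i).

Lemma coset_prodM : {in pow M &, {morph coset_prod : f g / f * g}}.
Proof.
move=> f g /powP Mf /powP Mg; rewrite /coset_prod.
pose P (u v w : coset_of N) := [/\ u \in M / N, v \in M / N & w = u * v].
suff []: P (\prod_i coset N (f i)) (\prod_i coset N (g i)) (\prod_i coset N ((f * g) i)) by [].
elim/big_rec3: _ => [|i u v w _ [Mu Mv ->]]; first by split; rewrite ?group1 // mulg1.
have cf : coset N (f i) \in M / N by rewrite mem_quotient.
have cg : coset N (g i) \in M / N by rewrite mem_quotient.
split; try exact: groupM.
rewrite mulg_ffun morphM ?(subsetP nNM) // -!mulgA; congr (_ * _).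
by rewrite !mulgA; congr (_ * _); apply: (centsP abMN).
Qed.
Canonical coset_prod_morphism := Morphism coset_prodM.

Lemma coset_prod_emb i x : coset_prod (emb i x) = coset N x.
Proof.
rewrite /coset_prod (big_only1 i) => [|//|j ne _]; rewrite embE ?eqxx //.
by rewrite (negPf ne) morph1.
Qed.

(** Modulo the antidiagonal generators, every tuple over M can be concentrated
    in the coordinate i0, where its product decides whether it is trivial. *)
Lemma antidiagE (i0 : I) : antidiag M N = 'ker coset_prod.
Proof.
have sL := antidiag_sub_pow sNM.
have sLk : antidiag M N \subset 'ker coset_prod.
  apply: antidiag_sub => [|i j x _ Mx].
    apply/subsetP=> f /powP Nf; apply/kerP; first exact/(subsetP (powS sNM))/powP.
    by rewrite /= /coset_prod big1 // => i _; rewrite coset_id.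
  apply/kerP; first by rewrite groupM ?mem_emb ?groupV.
  rewrite /= morphM ?mem_emb ?groupV //= !coset_prod_emb morphV ?mulgV //.
  exact: (subsetP nNM).
apply/eqP; rewrite eqEsubset sLk; apply/subsetP=> f kf.
have Mf := dom_ker kf.
have nLM : pow M \subset 'N(antidiag M N).
  apply: sub_der1_norm => //; apply: subset_trans (pow_antidiag M N).
  rewrite gen_subG; apply/subsetP=> _ /imset2P[g h /powP Mg /powP Mh ->].
  apply/powP=> i; rewrite ffunR.
  by apply: (subsetP (der1_min nNM abMN)); apply: mem_commg.
have nD : emb i0 @* M \subset 'N(antidiag M N).
  apply: subset_trans nLM; apply/subsetP=> _ /morphimP[x _ Mx ->].
  by rewrite -/(emb i0 x) mem_emb.
have: f \in antidiag M N <*> (emb i0 @* M).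
  apply: (subsetP (pow_sub _)) Mf => i x Mx.
  rewrite -[emb i x](mulgKV (emb i0 x)) groupM //.
    by rewrite mem_gen // inE -embV mem_antidiag.
  by rewrite mem_gen // inE orbC mem_morphim.
rewrite norm_joinEr // => /mulsgP[l _ Ll /morphimP[x _ Mx ->] ef].
have Lk := subsetP sLk _ Ll; move: kf; rewrite ef => kf.
have : emb i0 x \in 'ker coset_prod by rewrite -(groupMl _ Lk).
move/mker; rewrite /= coset_prod_emb => /coset_idr Nx.
rewrite groupM //; apply: (subsetP (pow_antidiag M N)).
by rewrite -/(emb i0 x) mem_emb Nx // (subsetP nNM).
Qed.

Lemma in_antidiag (i0 : I) f :
  (f \in antidiag M N) = (f \in pow M) && (\prod_i coset N (f i) == 1).
Proof.
rewrite (antidiagE i0); apply/idP/andP => [kf|[Mf /eqP pf]]; last exact/kerP.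
by split; [exact: dom_ker kf | apply/eqP; exact: (mker kf)].
Qed.

Lemma card_antidiag (i0 : I) :
  (#|antidiag M N| * #|M : N| = #|M| ^ #|I|)%N.
Proof.
rewrite -card_pow (antidiagE i0) -(Lagrange (subsetIl _ _ : 'ker coset_prod \subset pow M)) /=.
congr (_ * _)%N; rewrite -(card_quotient (ker_norm _)) (card_isog (first_isog _)).
rewrite -card_quotient //; congr #|pred_of_set _|.
apply/setP=> u; apply/morphimP/morphimP => [[x nx Mx ->]|[f Mf _ ->]].
  by exists (emb i0 x); rewrite ?mem_emb //= coset_prod_emb.
move: Mf => /powP Mf; rewrite /= /coset_prod.
suff : \prod_i coset N (f i) \in M / N by case/morphimP=> x ? ? ->; exists x.
by apply: group_prod => i _; rewrite mem_quotient.
Qed.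

End Quotient.

Definition slice (S : {group gTI}) i : {group gT} := (emb i @*^-1 S)%G.

Lemma mem_slice (S : {group gTI}) i x : (x \in slice S i) = (emb i x \in S).
Proof. by apply/morphpreP/idP => [[]//|Tx]; split; rewrite ?in_setT. Qed.

(** The map sending x to the tuple with x at i and x^-1 at j is a morphism
    modulo the power of the derived subgroup, so it suffices to test generators.
    *)
Lemma antidiag_gen_sub (X : {set gT}) N (S : {group gTI}) :
    <<X>>^`(1) \subset N -> pow N \subset S ->
    (forall i j x, i != j -> x \in X -> emb i x * emb j x^-1 \in S) ->
  antidiag <<X>> N \subset S.
Proof.
move=> sN NS XS; apply: antidiag_sub => // i j x ne; move: x.
pose D := [set x in <<X>> | emb i x * emb j x^-1 \in S].
have gD : group_set D.
  apply/group_setP; split=> [|x y]; first by rewrite inE group1 invg1 !emb1 mulg1 group1.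
  rewrite !inE => /andP[Xx Sx] /andP[Xy Sy]; rewrite groupM //=.
  have c : emb j [~ y^-1, x^-1] \in S.
    by rewrite (subsetP NS) // mem_emb (subsetP sN) // mem_commg ?groupV.
  have -> : emb i (x * y) * emb j (x * y)^-1 =
    emb i x * emb j x^-1 * (emb i y * emb j y^-1) * emb j [~ y^-1, x^-1].
    apply/ffunP=> k; rewrite !(mulg_ffun, embE); case: (eqVneq k i) => [->|_].
      by rewrite (negPf ne) !mulg1.
    by case: eqP => _; rewrite !mul1g // invMg; apply: commgC.
  by apply: groupM c; apply: groupM.
move=> x; rewrite -[x \in _]/(x \in <<X>>).
have: <<X>> \subset Group gD.
  rewrite gen_subG; apply/subsetP=> z Xz; rewrite inE mem_gen //=; exact: XS.
by move/subsetP=> s /s; rewrite inE => /andP[].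
Qed.

Section Subdirect.
Variables (G : {group gT}) (T : {group gTI}).
Hypotheses (sTG : T \subset pow G)
           (projT : forall i x, x \in G -> exists2 t, t \in T & t i = x).

(** T acts on coordinate i through all of G. *)
Lemma slice_norm (S : {group gTI}) i : T \subset 'N(S) -> G \subset 'N(slice S i).
Proof.
move=> nST; apply/subsetP=> x Gx; rewrite inE; apply/subsetP=> _ /imsetP[y Hy ->].
have [t Tt <-] := projT i Gx.
by rewrite mem_slice -embJ memJ_norm ?(subsetP nST) // -mem_slice.
Qed.

Lemma pow_norm_sub M : G \subset 'N(M) -> T \subset 'N(pow M).
Proof.
move=> nMG; apply/subsetP=> t /(subsetP sTG)/powP Gt.
by apply: pow_norm => i; apply: (subsetP nMG).
Qed.

(** The commutators of a tuple concentrated at i with the elements of T are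
    concentrated at i, and T has elements with any prescribed coordinate i. *)
Lemma lcn_lift_step n :
    pow 'L_n.+1(G) \subset T <*> pow 'L_n.+2(G) ->
  pow 'L_n.+2(G) \subset T <*> pow 'L_n.+3(G).
Proof.
have nL m := pow_norm_sub (lcn_norm m G).
rewrite (norm_joinEl (nL n.+2)) => sL.
have comm_pow f g : f \in pow 'L_n.+2(G) -> g \in pow G -> [~ f, g] \in pow 'L_n.+3(G).
  by move=> /powP Lf /powP Gg; apply/powP=> i; rewrite ffunR lcnSn mem_commg.
apply: pow_sub => i x Lx.
suff: 'L_n.+2(G) \subset emb i @*^-1 (T <*> pow 'L_n.+3(G)).
  by move/subsetP/(_ x Lx)/morphpreP=> [].
rewrite lcnSn gen_subG; apply/subsetP=> _ /imset2P[{Lx}x g Lx Gg ->].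
rewrite mem_morphpre ?inE //=.
have [t Tt tg] := projT i Gg.
have /mulsgP[s y Ts Ly ex]: emb i x \in T * pow 'L_n.+2(G).
  by rewrite (subsetP sL) // mem_emb.
have -> : emb i [~ x, g] = [~ s * y, t].
  by rewrite -ex /commg embM embJ embV tg.
have Gs := subsetP sTG s Ts; have Gt := subsetP sTG t Tt.
rewrite commMgJ; set c := [~ s, t].
have Tc : c \in T by rewrite groupR.
have cJ : c ^ y = c * [~ c, y] by rewrite mulKVg.
rewrite cJ -mulgA groupM //; first by rewrite mem_gen // inE Tc.
rewrite mem_gen // inE; apply/orP; right.
apply: groupM; last exact: comm_pow.
by rewrite -invg_comm groupV comm_pow // groupR.
Qed.

(** In a nilpotent group it suffices to contain the derived power up to deeper
    commutators: the approximation improves along the lower central series,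
    which ends at the trivial group. *)
Lemma lcn_lift : nilpotent G ->
  pow 'L_2(G) \subset T <*> pow 'L_3(G) -> pow 'L_2(G) \subset T.
Proof.
case/lcnP=> n Ln s2.
have sk m : pow 'L_m.+2(G) \subset T <*> pow 'L_m.+3(G).
  by elim: m => // m; apply: lcn_lift_step.
have: pow 'L_n.+2(G) \subset T.
  apply: pow_sub => i x Lx.
  have : x \in 'L_n.+1(G) by apply: subsetP (lcn_subS _ _) _ Lx.
  by rewrite Ln => /set1P->; rewrite emb1.
elim: n {Ln} => // n IHn sT; apply: IHn.
by apply: subset_trans (sk n) _; rewrite join_subG subxx.
Qed.

End Subdirect.

End Power.
Arguments pow {I gT} A.
Arguments pow_group {I gT} M.
Arguments antidiag {I gT} M N.
Arguments antidiag_group {I gT} M N.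

(** * Exponents in a prime field *)

Section Exponents.
Variables (gT : finGroupType) (p : nat) (a : gT).
Hypotheses (p_pr : prime p) (ap : a ^+ p = 1).
Implicit Types x y : 'F_p.

Lemma expF_mod n : a ^+ (n %% (Zp_trunc (pdiv p)).+2) = a ^+ n.
Proof. by rewrite Fp_cast // [in RHS](divn_eq n p) expgD mulnC expgM ap expg1n mul1g. Qed.

Lemma expFD x y : a ^+ (x + y)%R = a ^+ x * a ^+ y.
Proof. by rewrite /= expF_mod expgD. Qed.

Lemma expFM x y : a ^+ (x * y)%R = (a ^+ x) ^+ y.
Proof. by rewrite /= expF_mod expgM. Qed.

Lemma expF1 : a ^+ (1%R : 'F_p) = a.
Proof. by rewrite /= modn_small ?expg1 // Fp_cast ?prime_gt1. Qed.

Lemma expF_cancel x : x != 0%R -> (a ^+ x) ^+ (x^-1)%R = a.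
Proof. by move=> nz; rewrite -expFM divff // expF1. Qed.

End Exponents.

(** * The first level stabilizer inside the power of the group *)

Section OneLevel.
Variable q : nat.
Local Notation p := q.+2.
Hypotheses (p_pr : prime p) (p_odd : odd p).
Variable gT : finGroupType.
Notation gTI := {dffun forall i : 'I_p, (fun=> gT) i}.

Local Notation pow A := (pow A : {set gTI}).
Local Notation antidiag M N := (antidiag M N : {set gTI}).

(** The image under psi of the conjugate of b by a power of a that has b in
    coordinate i. E is the defining vector indexed by the residues modulo p,
    with E 0 = 0. *)
Definition psi_b (a b : gT) (E : 'I_p -> 'F_p) (i : 'I_p) : gTI :=
  [ffun k => if k == i then b else a ^+ E (k - i)%R].

(** The image under psi of the stabilizer of the first level. *)
Definition psi_stab a b E : {group gTI} := <<[set psi_b a b E i | i : 'I_p]>>%G.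

Variables (a b : gT) (E : 'I_p -> 'F_p).
Hypotheses (ap : a ^+ p = 1) (bp : b ^+ p = 1) (E0 : E 0%R = 0%R).
Local Notation be := (psi_b a b E).
Local Notation T := (psi_stab a b E).
Let G := <<[set a; b]>>%G.

Lemma psi_bE i k : be i k = if k == i then b else a ^+ E (k - i)%R.
Proof. by rewrite ffunE. Qed.

Lemma mem_psi_b i : be i \in T.
Proof. by rewrite mem_gen // imset_f. Qed.

Lemma psi_stab_sub : T \subset pow G.
Proof.
rewrite gen_subG; apply/subsetP=> _ /imsetP[i _ ->]; apply/powP=> k; rewrite psi_bE.
by case: eqP => _; rewrite ?groupX ?gen2_l ?gen2_r.
Qed.

(** Coordinate i of [psi_b i] is b, and that of [psi_b (i - d)] is a^(E d),
    which generates <a>. *)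
Lemma psi_stab_proj : (exists d, E d != 0%R) ->
  forall i x, x \in G -> exists2 t : gTI, t \in T & t i = x.
Proof.
case=> d nz i x.
suff: G \subset dffun_morphism (fun=> gT) i @* T.
  move=> sG /(subsetP sG)/morphimP[t _ Tt ->]; by exists t.
have mp t : t \in T -> t i \in dffun_morphism (fun=> gT) i @* T.
  by move=> Tt; apply/morphimP; exists t; rewrite ?in_setT.
rewrite gen_subG; apply/subsetP=> _ /set2P[]->; last first.
  by have := mp _ (mem_psi_b i); rewrite psi_bE eqxx.
have ead : be (i - d)%R i = a ^+ E d.
  rewrite psi_bE subKr; case: eqP => // e.
  by move: nz; rewrite -[d](subKr i) -e subrr E0 eqxx.
have := mp _ (mem_psi_b (i - d)%R); rewrite ead.
by move/(groupX (E d)^-1%R); rewrite (expF_cancel p_pr ap nz).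
Qed.

Lemma psi_b_exp i : be i ^+ p = 1.
Proof.
apply/ffunP=> k; rewrite ffunX psi_bE [in RHS]ffunE; case: eqP => // _.
by rewrite -expgM mulnC expgM ap expg1n.
Qed.

Lemma psi_b_comm i j k : [~ be i, be j] k =
  if i == j then 1 else
  if k == i then [~ b, a ^+ E (i - j)%R] else
  if k == j then [~ a ^+ E (j - i)%R, b] else 1.
Proof.
case: eqVneq => [->|ne]; first by rewrite commgg ffunE.
rewrite ffunR !psi_bE; case: (eqVneq k i) => [->|nki].
  by rewrite (negPf ne).
case: eqP => [->//|_]; apply/eqP/commgP/commuteX2/commute_refl.
Qed.

Lemma psi_b_comm_emb (i j : 'I_p) : i != j ->
  [~ be i, be j] = emb i [~ b, a ^+ E (i - j)%R] * emb j [~ a ^+ E (j - i)%R, b].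
Proof.
move=> ne; apply/ffunP=> k; rewrite psi_b_comm (negPf ne) mulg_ffun !embE.
case: eqP => [->|_]; first by rewrite (negPf ne) mulg1.
by case: eqP; rewrite mul1g.
Qed.

(** Two generators commute outside of the two coordinates where they have b. *)
Lemma psi_stab_comm_emb (i d : 'I_p) : d != 0%R ->
  emb (i + d : 'I_p)%R [~ a ^+ E d, b] * (emb i [~ a ^+ E (- d)%R, b])^-1 \in T.
Proof.
move=> d0; have ne : i != (i + d : 'I_p)%R by rewrite eq_sym -subr_eq0 addrAC subrr add0r.
have := groupR (mem_psi_b i) (mem_psi_b (i + d : 'I_p)%R); rewrite psi_b_comm_emb //.
rewrite opprD addrA subrr add0r addrAC subrr add0r -invg_comm.
by rewrite (emb_commute _ _ ne) embV.
Qed.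

Section NonSymmetric.
Hypotheses (pG : p.-group G).
Variable (d : 'I_p).
Hypothesis (asymE : E d != E (- d)%R).
Local Notation z := [~ a, b].
Local Notation U := (T <*> pow 'L_3(G)).

Lemma asym_neq0 : exists c, E c != 0%R.
Proof.
have [Ed|?] := eqVneq (E d) 0%R; last by exists d.
by exists (- d)%R; rewrite -Ed eq_sym.
Qed.

Lemma asym_step (i : 'I_p) :
  emb (i + d : 'I_p)%R z ^+ E d * (emb i z ^+ E (- d)%R)^-1 \in U.
Proof.
have dn0 : d != 0%R by apply: contraNneq asymE => ->; rewrite oppr0.
have [l Ll el] := commX_lcn3 a b (E d).
have [m Lm em] := commX_lcn3 a b (E (- d)%R).
have := psi_stab_comm_emb i dn0; rewrite el em.
rewrite -!embX [emb _ (_ * l)]embM [emb _ (_ * m)]embM invMg.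
have Gz : z \in G by rewrite groupR ?gen2_l ?gen2_r.
have nL x (j : 'I_p) : x \in G -> emb j x \in 'N(pow 'L_3(G)).
  move=> Gx; apply: pow_norm => k; rewrite (subsetP (lcn_norm 3 G)) // embE.
  by case: eqP.
set A := emb (i + d : 'I_p)%R _; set B := emb i (z ^+ _); move=> Tc.
have wL : (emb (i + d : 'I_p)%R l * (emb i m)^-1) ^ B^-1 \in pow 'L_3(G).
  rewrite memJ_norm ?groupV ?nL ?groupX // groupM ?groupV //; by rewrite mem_emb.
rewrite -(mulgK ((emb (i + d : 'I_p)%R l * (emb i m)^-1) ^ B^-1) (A * _)).
apply: groupM; last by rewrite groupV mem_gen // inE wL orbT.
rewrite mem_gen // inE; apply/orP; left.
by rewrite conjgE invgK !mulgA mulgKV -!mulgA mulgA in Tc *.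
Qed.

Lemma emb_z_commute (i j : 'I_p) m n : commute (emb i z ^+ m) (emb j z ^+ n).
Proof.
apply: commuteX2; have [->|] := eqVneq i j; first exact: commute_refl.
exact: emb_commute.
Qed.

(** Iterating [asym_step] along the positions i, i + d, i + 2d and so on, which
    come back to i after p steps. *)
Lemma asym_walk (i : 'I_p) k :
  emb (i + d *+ k : 'I_p)%R z ^+ (E d ^ k) * (emb i z ^+ (E (- d)%R ^ k))^-1 \in U.
Proof.
elim: k => [|k IHk]; first by rewrite mulr0n addr0 mulgV group1.
set y := nat_of_ord (E d) in IHk *; set x := nat_of_ord (E (- d)%R) in IHk *.
have H1 := groupX (y ^ k) (asym_step (i + d *+ k : 'I_p)%R).
have H2 := groupX x IHk.
rewrite expgMn in H1; last by apply: commuteV; apply: emb_z_commute.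
rewrite expgMn in H2; last by apply: commuteV; apply: emb_z_commute.
have := groupM H1 H2; rewrite !expVgn -!expgM -/x -/y -addrA -mulrSr.
rewrite [(y ^ k * x)%N]mulnC -!mulgA mulKg -expnS.
by rewrite mulnC -expnS.
Qed.

(** Once the walk has come back to i, T contains, modulo the power of L_3(G),
    the power y^p - x^p of z in coordinate i alone, where x = E (- d) and y = E
    d. As y^p - x^p is congruent to y - x modulo p and z has p-power order, z
    itself is obtained. *)
Lemma asym_der1 : pow 'L_2(G) \subset T.
Proof.
have Gz : z \in G by rewrite groupR ?gen2_l ?gen2_r.
apply: (lcn_lift psi_stab_sub (psi_stab_proj asym_neq0)); first exact: pgroup_nil pG.
apply: pow_sub => i; apply/subsetP.
suff: G^`(1) \subset slice U i.
  by move/subsetP=> s; apply/subsetP=> x /s; rewrite mem_slice.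
apply: der1_sub_lcn3.
  apply/subsetP=> l Ll; rewrite mem_slice mem_gen // inE.
  by rewrite [X in _ || X]mem_emb Ll orbT.
rewrite mem_slice; have := asym_walk i p.
have -> : (i + d *+ p = i :> 'I_p)%R.
  by apply/val_inj; rewrite Zp_mulrn /= modnMl addn0 modn_small.
set y := nat_of_ord (E d); set x := nat_of_ord (E _) => Uxy.
have neq : ((y ^ p)%N%:R != (x ^ p)%N%:R :> 'F_p)%R.
  rewrite !natrX !natr_Zp.
  by have fr (u : 'F_p) : (u ^+ p = u)%R; [have := expf_card u; rewrite card_Fp | rewrite !fr].
have cop m n : m <= n -> (m%:R != n%:R :> 'F_p)%R -> z ^+ (n - m) \in slice U i -> z \in slice U i.
  move=> le_mn neF; rewrite -cycle_subG => sH; rewrite -cycle_subG.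
  suff /eqP-> : generator <[z]> (z ^+ (n - m)) by [].
  rewrite generator_coprime (@pnat_coprime p) //; first exact: (mem_p_elt pG Gz).
  rewrite p'natE //; apply: contra neF => /dvdnP[k ek].
  by rewrite -(subnK le_mn) ek natrD natrM [p%:R%R]pchar_Fp_0 // mulr0 add0r.
have expB m n : m <= n -> emb i z ^+ n * (emb i z ^+ m)^-1 = emb i (z ^+ (n - m)).
  by move=> le_mn; rewrite -!embX -embV -embM -{1}(subnK le_mn) expgD mulgK.
(* the exponents are natural numbers, so the sign of their difference matters *)
case: (leqP (x ^ p) (y ^ p)) => [le|/ltnW le].
  by rewrite -mem_slice; apply: (cop _ _ le); rewrite 1?eq_sym // mem_slice -expB.
rewrite -mem_slice; apply: (cop _ _ le); rewrite // mem_slice -expB //.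
by rewrite -groupV invMg invgK.
Qed.
End NonSymmetric.

Section Cardinality.
Hypotheses (pG : p.-group G) (nabG : ~~ abelian G).

(** Modulo the normal subgroup generated by a, the generator [psi_b i] is b in
    coordinate i and trivial elsewhere. *)
Lemma psi_stab_mul_pow :
  pow G \subset T <*> pow (G^`(1) <*> <[a]>).
Proof.
set N := (G^`(1) <*> <[a]>)%G.
have Na : a \in N by rewrite mem_gen // inE cycle_id orbT.
apply: pow_sub => i x.
suff: G \subset slice (T <*> pow N) i by move/subsetP=> s /s; rewrite mem_slice.
rewrite gen_subG; apply/subsetP=> _ /set2P[]->; rewrite mem_slice.
  by rewrite mem_gen // inE [X in _ || X]mem_emb Na orbT.
rewrite -(mulKVg (be i) (emb i b)) groupM //; first by rewrite mem_gen // inE mem_psi_b.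
rewrite mem_gen // inE; apply/orP; right; apply/powP=> k.
rewrite mulg_ffun invg_ffun embE psi_bE; case: eqP => _; first by rewrite mulVg group1.
by rewrite mulg1 groupV groupX.
Qed.

(** T / L is an elementary abelian group generated by p elements, so its order
    is at most p^p. It is at least p^p because T maps onto the power of the
    cyclic group G / G'<a> of order p, with L in the kernel. *)
Lemma card_psi_stab (L : {group gTI}) :
    L \subset T -> T \subset 'N(L) -> L \subset pow G^`(1) ->
    (forall i j, [~ be i, be j] \in L) ->
  #|T| = (p ^ p * #|L|)%N.
Proof.
move=> sLT nLT sLG cL.
have nilG := pgroup_nil pG.
pose N := (G^`(1) <*> <[a]>)%G.
have sNG : N \subset G by rewrite join_subG der_sub cycle_subG gen2_l.
have nNG : G \subset 'N(N) by rewrite sub_der1_norm // joing_subl.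
have nT : T \subset 'N(pow N) by apply: pow_norm_sub psi_stab_sub _ nNG.
have iGN : (#|N| * p = #|G|)%N.
  by rewrite -(index_der1_joinl p_pr bp nilG nabG) Lagrange.
have eT : (#|T| = p ^ p * #|T :&: pow N|)%N.
  have := mul_cardG T (pow_group N); rewrite -norm_joinEl //.
  have -> : T <*> pow N = pow G.
    by apply/eqP; rewrite eqEsubset psi_stab_mul_pow join_subG psi_stab_sub powS.
  rewrite /= !card_pow card_ord -iGN expnMn [(_ ^ _ * p ^ p)%N]mulnC -mulnA mulnC.
  by move/eqP; rewrite mulnCA eqn_pmul2l ?expn_gt0 ?cardG_gt0 // => /eqP.
have leL : #|L| <= #|T :&: pow N|.
  by rewrite subset_leq_card // subsetI sLT (subset_trans sLG) // powS // joing_subl.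
have le : #|T / L| <= p ^ p.
  have eTL : T / L = <<[set be i | i : 'I_p] / L>>.
    rewrite quotient_gen //; apply/subsetP=> _ /imsetP[i _ ->].
    exact: (subsetP nLT _ (mem_psi_b i)).
  have ab : abelian (T / L).
    rewrite eTL abelian_gen /abelian quotient_cents2r // gen_subG.
    by apply/subsetP=> _ /imset2P[_ _ /imsetP[i _ ->] /imsetP[j _ ->] ->].
  have LD : T / L \subset 'Ldiv_p().
    apply: subset_trans (_ : Group (group_Ldiv p ab) \subset _); last exact: subsetIr.
    rewrite {1}eTL gen_subG; apply/subsetP=> _ /morphimP[x nx /imsetP[i _ ex] ->].
    rewrite {x}ex in nx *; rewrite !inE mem_quotient ?mem_psi_b //=.
    have e1 : coset L (be i ^+ p) = 1 by rewrite psi_b_exp morph1.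
    by have /= := morphX (coset_morphism L) p nx; rewrite e1 => <-.
  have eab : p.-abelem (T / L) by rewrite abelemE // ab -sub_LdivT.
  have m_le : 'm(T / L) <= p.
    rewrite eTL; apply: leq_trans (grank_min _) _; apply: leq_trans (leq_morphim _ _) _.
    by apply: leq_trans (leq_imset_card _ _) _; rewrite card_ord.
  rewrite (card_pgroup (abelem_pgroup eab)) leq_exp2l ?prime_gt1 //.
  by rewrite -(rank_abelem eab) -(grank_abelian ab).
apply/eqP; rewrite eqn_leq; apply/andP; split.
  by rewrite -(Lagrange sLT) mulnC -card_quotient // leq_mul2r le orbT.
by rewrite eT leq_mul2l leL orbT.
Qed.

Lemma card_psi_stab_asym d : E d != E (- d)%R -> #|T| = (p ^ p * #|G^`(1)| ^ p)%N.
Proof.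
move=> asymE.
have sL : pow G^`(1) \subset T by exact: asym_der1 pG d asymE.
rewrite (@card_psi_stab (pow_group (G^`(1))%G)) //=; first by rewrite card_pow card_ord.
- exact: pow_norm_sub psi_stab_sub _ (der_norm 1 G).
- move=> i j; apply/powP=> k; rewrite ffunR.
  by have Gb c := powP _ _ (subsetP psi_stab_sub _ (mem_psi_b c)); apply: mem_commg.
Qed.
End Cardinality.
End OneLevel.

(** * Symmetric vectors *)

Section SymVec.
Variable q : nat.
Local Notation p := q.+2.
Hypotheses (p_pr : prime p) (p_odd : odd p).
Variable (E : 'I_p -> 'F_p) (d : 'I_p).
Local Open Scope ring_scope.
Hypotheses (d0 : d != 0).

Lemma ord_unit : d \is a GRing.unit.
Proof.
rewrite -[d]natr_Zp (@unitZpE p) // prime_coprime // gtnNdvd //.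
by rewrite lt0n.
Qed.

Lemma ord_mulrn (i : 'I_p) : exists2 k, (k < p)%N & i = d *+ k.
Proof.
exists (i / d : 'I_p); first exact: ltn_ord.
by rewrite -mulr_natr natr_Zp mulrC (divrK ord_unit).
Qed.

Lemma ord_mulrn_eq0 k : (k < p)%N -> (d *+ k == 0 :> 'I_p) = (k == 0%N).
Proof.
move=> lt; rewrite -mulr_natl (mulIr_eq0 _ (mulIr ord_unit)) -val_eqE /= Zp_nat /=.
by rewrite modn_small.
Qed.

Hypotheses (symE : forall c, E (- c) = E c) (Ed : E d != 0).

(** If all these minors vanished, E would be geometric along the multiples of d,
    E ((k + 1) d) = l^k E d; then E (- d) = E d forces l^(p - 2) = 1, hence l =
    1 and E would be constant. *)
Lemma sym_minor c : c != 0 -> E c != E d ->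
  exists n, [/\ n != 0, n != - d & E d * E (n + d) != E n * E (d + d)].
Proof.
move=> c0 Ec.
have [n /and3P[]|none] := pickP (fun n => [&& n != 0, n != - d & E d * E (n + d) != E n * E (d + d)]).
  by exists n.
pose l := E (d + d) / E d.
have El n : n != 0 -> n != - d -> E (n + d) = l * E n.
  move=> n0 nd; have := none n; rewrite n0 nd /= => /negbFE/eqP e.
  by apply: (mulfI Ed); rewrite e /l mulrA [E d * _]mulrC divfK // mulrC.
have Ek k : (k.+1 < p)%N -> E (d *+ k.+1) = l ^+ k * E d.
  elim: k => [|k IHk] lt; first by rewrite mul1r.
  rewrite mulrSr El ?ord_mulrn_eq0 ?(ltnW lt) //; first by rewrite IHk ?(ltnW lt) // exprS mulrA.
  by rewrite -addr_eq0 -mulrSr ord_mulrn_eq0.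
have l1 : l = 1.
  have lq : l ^+ q = 1.
    apply: (mulIf Ed); rewrite mul1r -Ek // -symE; congr (E _).
    by apply/eqP; rewrite eq_sym -addr_eq0 -mulrS -mulr_natr Zp_nat (_ : inZp _ = 0) ?mulr0 //; apply/val_inj; rewrite /= modnn.
  have lp : l ^+ p = l by have := expf_card l; rewrite card_Fp.
  have l2 : l * l = l * 1 by rewrite mulr1 -[RHS]lp !exprSr lq mul1r.
  apply: (mulfI _ l2); apply/eqP => l0; move: lq; rewrite l0 expr0n.
  have -> : (q == 0%N) = false by case: q p_odd.
  by move/eqP; rewrite eq_sym oner_eq0.
have [[|k] lt ck] := ord_mulrn c; first by rewrite ck mulr0n eqxx in c0.
by rewrite ck Ek // l1 expr1n mul1r eqxx in Ec.
Qed.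

Lemma ord_double_neq0 : d + d != 0.
Proof. by rewrite -mulr2n ord_mulrn_eq0 //; case: q p_odd. Qed.

End SymVec.

(** * Symmetric non-constant defining vectors *)

Section SymmetricLevel.
Variable q : nat.
Local Notation p := q.+2.
Hypotheses (p_pr : prime p) (p_odd : odd p).
Variable gT : finGroupType.
Notation gTI := {dffun forall i : 'I_p, (fun=> gT) i}.
Local Notation pow A := (pow A : {set gTI}).
Local Notation antidiag M N := (antidiag M N : {set gTI}).
Variables (a b : gT) (E : 'I_p -> 'F_p).
Hypotheses (ap : a ^+ p = 1) (bp : b ^+ p = 1) (E0 : E 0%R = 0%R).
Local Notation be := (psi_b a b E).
Local Notation T := (psi_stab a b E).
Let G := <<[set a; b]>>%G.
Hypotheses (pG : p.-group G) (nabG : ~~ abelian G).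
Hypotheses (symE : forall c, E (- c)%R = E c).
Variables (d c : 'I_p).
Hypotheses (Ed : E d != 0%R) (c0 : c != 0%R) (Ec : E c != E d).

Let proj : forall (i : 'I_p) x, x \in G -> exists2 t : gTI, t \in T & t i = x.
Proof. by apply: psi_stab_proj => //; exists d. Qed.

Let d0 : d != 0%R.
Proof. by apply: contraNneq Ed => ->; rewrite E0. Qed.

Lemma gen2_expl : <<[set a ^+ E d; b]>> = G.
Proof.
apply/eqP; rewrite eqEsubset !gen_subG; apply/andP; split; apply/subsetP=> x /set2P[]->.
- by rewrite groupX ?gen2_l.
- exact: gen2_r.
- by have := groupX (E d)^-1%R (gen2_l (a ^+ E d) b); rewrite (expF_cancel p_pr ap Ed).
- exact: gen2_r.
Qed.

Local Notation X := [~ a ^+ E d, b].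

Lemma mem_X : X \in G.
Proof. by rewrite groupR ?groupX ?gen2_l ?gen2_r. Qed.

(** G' is generated by X modulo L_3(G), since a^(E d) and b still generate G. *)
Lemma der1_cycleX x : x \in G^`(1) ->
  exists2 l, l \in 'L_3(G) & exists n, x = l * X ^+ n.
Proof.
have nLX : <[X]> \subset 'N('L_3(G)) by rewrite cycle_subG (subsetP (lcn_norm 3 G)) // mem_X.
have sJ : G^`(1) \subset 'L_3(G) <*> <[X]>.
  have := @der1_sub_lcn3 _ (a ^+ E d) b ('L_3(G) <*> <[X]>)%G.
  by rewrite /= gen2_expl; apply; [exact: joing_subl | rewrite -cycle_subG joing_subr].
move/(subsetP sJ); rewrite norm_joinEr // => /mulsgP[l y Ll /cycleP[n ->] ->].
by exists l => //; exists n.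
Qed.

(** The commutator of the generators at i and i + d has X^-1 at i and X at i +
    d, so commuting it with an element of T trivial at i isolates coordinate i +
    d. *)
Lemma step_comm (i : 'I_p) t : t \in T -> t i = 1 ->
  [~ X, t (i + d)%R] \in slice T (i + d : 'I_p)%R.
Proof.
move=> Tt ti; have ne : i != (i + d)%R by rewrite eq_sym -subr_eq0 addrAC subrr add0r.
have := groupR (psi_stab_comm_emb a b E i d0) Tt; rewrite mem_slice.
rewrite symE; set u := [~ _, t] => Tu.
suff -> : emb (i + d : 'I_p)%R [~ X, t (i + d)%R] = u by [].
apply/ffunP=> k; rewrite /u ffunR mulg_ffun invg_ffun !embE.
case: (eqVneq k (i + d)%R) => [->|nk]; first by rewrite eq_sym (negPf ne) invg1 mulg1.
by case: eqP => [->|_]; rewrite ?ti ?commg1 // mul1g invg1 comm1g.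
Qed.

(** It suffices to find in T two elements trivial at coordinate j - d whose
    coordinates at j generate G. The first is a product of powers of two
    generators, and has a nontrivial power of a at j by [sym_minor]; the second
    is a quotient of two generators, trivial at j - d by symmetry and equal to b
    times a power of a at j. *)
Lemma slice_X (j : 'I_p) g : g \in G -> [~ X, g] \in slice T j.
Proof.
pose i : 'I_p := (j - d)%R; have ej : (i + d)%R = j by rewrite subrK.
have nH := slice_norm proj j (normG _).
have nHX : X \in 'N(slice T j) by rewrite (subsetP nH) // mem_X.
pose C := (coset_morphism (slice T j) @*^-1 'C[coset (slice T j) X])%G.
have memC h : h \in G -> (h \in C) = ([~ X, h] \in slice T j).
  move=> Gh; have nh := subsetP nH h Gh.
  apply/morphpreP/idP => [[_ /cent1P cX]|].
    apply: coset_idr; first by rewrite groupR.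
    by rewrite morphR //; apply/eqP/commgP/commute_sym.
  move=> /coset_id; rewrite morphR // => /eqP/commgP cX; split=> //.
  exact/cent1P/commute_sym.
move=> Gg; rewrite -memC //; apply: subsetP g Gg.
have step t : t \in T -> t i = 1 -> t j \in C.
  move=> Tt ti; have Gtj : t j \in G by have /powP := subsetP (psi_stab_sub a b E) _ Tt.
  by rewrite memC // -{1}ej; have := step_comm Tt ti; rewrite ej.
have bE k l : k != l -> be k l = a ^+ E (l - k)%R by rewrite psi_bE eq_sym => /negPf->.
have addNe (u v : 'I_p) : v != 0%R -> (u - v)%R != u.
  by move=> v0; rewrite -subr_eq0 addrAC subrr add0r oppr_eq0.
have Ca : a \in C.
  have [n [n0 nd En]] := sym_minor p_pr p_odd d0 symE Ed c0 Ec.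
  (* the generators at k and l have the exponents E d and E n at i, and the
     exponents E (d + d) and E (n + d) at j *)
  pose k : 'I_p := (i - d)%R; pose l : 'I_p := (i - n)%R.
  have dd := ord_double_neq0 p_pr p_odd d0.
  have jk : (j - k)%R = (d + d)%R by apply/eqP; rewrite -ej subr_eq /k addrCA addrK.
  have jl : (j - l)%R = (n + d)%R by apply/eqP; rewrite -ej subr_eq /l [(n + d)%R]addrC addrCA addrK.
  have nkj : k != j by rewrite eq_sym -subr_eq0 jk.
  have nlj : l != j by rewrite eq_sym -subr_eq0 jl addr_eq0.
  have := step (be k ^+ E n * be l ^+ (- E d)%R).
  rewrite !mulg_ffun !ffunX !bE ?addNe // jk jl !subKr.
  rewrite -!(expFM p_pr ap) -!(expFD p_pr ap) => cE.
  have : a ^+ (E (d + d) * E n + E (n + d) * - E d)%R \in C.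
    apply: cE; first by rewrite groupM ?groupX ?mem_psi_b.
    by rewrite mulrN mulrC subrr.
  move/(groupX (E (d + d) * E n + E (n + d) * - E d)^-1%R).
  rewrite (expF_cancel p_pr ap) // mulrN subr_eq0 eq_sym.
  by rewrite mulrC [X in _ != X]mulrC.
rewrite gen_subG; apply/subsetP=> _ /set2P[]-> //.
have := step (be j * (be (i - d)%R)^-1); rewrite !mulg_ffun !invg_ffun.
have nij : j != i by rewrite -subr_eq0 -ej addrAC subrr add0r.
have njd : (i - d)%R != j.
  rewrite -ej subr_eq -addrA eq_sym -subr_eq0 addrAC subrr add0r; exact: ord_double_neq0.
rewrite (bE j i) // [be j j]psi_bE eqxx !bE ?addNe // subKr.
have -> : (i - j = - d)%R by rewrite -ej opprD addrA subrr add0r.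
rewrite symE mulgV => /(_ _ erefl); rewrite groupM ?groupV ?mem_psi_b // => /(_ isT).
by rewrite groupMr // groupV groupX.
Qed.

(** By [slice_X], X is central modulo the elements that T contains in a single
    coordinate. *)
Lemma sym_lcn3 : pow 'L_3(G) \subset T.
Proof.
apply: pow_sub => j x; rewrite -mem_slice; apply/subsetP: x.
have nH := slice_norm proj j (normG _).
have := @lcn3_gen2_sub _ (a ^+ E d) b (slice T j); rewrite /= gen2_expl.
by apply=> // g Gg; apply: slice_X.
Qed.

(** Two coordinates at distance d carry an antidiagonal pair by the commutator
    of generators; since d generates the residues modulo p, telescoping gives
    any two coordinates. *)
Lemma sym_antidiag : antidiag G^`(1) 'L_3(G) \subset T.
Proof.
apply: antidiag_sub; first exact: sym_lcn3.
have Tl l j : l \in 'L_3(G) -> emb j l \in T.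
  by move=> Ll; rewrite (subsetP sym_lcn3) // mem_emb.
have step (i : 'I_p) x : x \in G^`(1) -> emb (i + d : 'I_p)%R x * (emb i x)^-1 \in T.
  move=> /der1_cycleX[l Ll [n ->]].
  have := psi_stab_comm_emb a b E i d0; rewrite symE => /(groupX n).
  rewrite expgMn; last first.
    by apply/commuteV/emb_commute; rewrite -subr_eq0 addrAC subrr add0r.
  rewrite expVgn -!embX !embM invMg => TX.
  rewrite -!mulgA groupM ?Tl // mulgA groupM ?groupV ?Tl //.
have walk (i : 'I_p) k x : x \in G^`(1) -> emb (i + d *+ k : 'I_p)%R x * (emb i x)^-1 \in T.
  move=> Gx; elim: k => [|k IHk]; first by rewrite mulr0n addr0 mulgV group1.
  have := groupM (step (i + d *+ k)%R x Gx) IHk.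
  by rewrite mulgA mulgKV -addrA -mulrSr.
move=> i j x ne Gx; have [k _ ek] := ord_mulrn p_pr d0 (i - j)%R.
by have := walk j k x Gx; rewrite -ek addrC subrK embV.
Qed.

Lemma card_psi_stab_sym : (#|T| * p = p ^ p * #|G^`(1)| ^ p)%N.
Proof.
have sLG : 'L_3(G) \subset G^`(1) by exact: (lcn_sub_leq G (isT : 2 <= 3)).
have nLG := subset_trans (der_sub 1 G) (lcn_norm 3 G).
have abL : abelian (G^`(1) / 'L_3(G)).
  by apply: sub_der1_abelian; rewrite /= lcnSn commgS // der_sub.
rewrite (@card_psi_stab _ p_pr _ _ _ _ ap bp pG nabG (antidiag_group G^`(1) 'L_3(G))) //.
- have := card_antidiag sLG nLG abL (0%R : 'I_p).
  rewrite (index_lcn3_gen2 p_pr ap (pgroup_nil pG) nabG) card_ord => <-.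
  by rewrite mulnA.
- exact: sym_antidiag.
- apply/subsetP=> t /(subsetP (psi_stab_sub a b E))/powP Gt.
  apply: antidiag_norm => [i|i|i j x Gx].
  + exact: (subsetP (der_norm 1 G)).
  + exact: (subsetP (lcn_norm 3 G)).
  have comL i' : [~ x, t i'] \in 'L_3(G) by rewrite lcnSn mem_commg.
  have Gxx := subsetP (der_sub 1 G) x Gx.
  have -> : x ^ t i * (x ^ t j)^-1 = ([~ x, t i] * [~ x, t j]^-1) ^ x^-1.
    by rewrite [RHS]conjgE !conjg_mulR invgK invMg !mulgA.
  have nx : x^-1 \in 'N('L_3(G)) by rewrite groupV (subsetP (lcn_norm 3 G)).
  by rewrite memJ_norm // groupM ?groupV ?comL.
- exact: antidiag_sub_pow.
move=> i j; have [->|ne] := eqVneq i j; first by rewrite commgg group1.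
rewrite psi_b_comm_emb // -[(i - j)%R]opprB symE emb_commute //.
rewrite -[[~ b, _]]invg_comm mem_antidiag // mem_commg ?groupX ?gen2_l ?gen2_r //.
Qed.

End SymmetricLevel.

(** * Constant defining vectors *)

Section ConstantLevel.
Variable q : nat.
Local Notation p := q.+2.
Hypotheses (p_pr : prime p) (p_odd : odd p).
Variable gT : finGroupType.
Notation gTI := {dffun forall i : 'I_p, (fun=> gT) i}.
Local Notation pow A := (pow A : {set gTI}).
Local Notation antidiag M N := (antidiag M N : {set gTI}).

Definition ones (c : 'I_p) : 'F_p := if c == 0%R then 0%R else 1%R.

Definition ydiff (a b : gT) : {set gT} := (b * a^-1) ^: <[a]>.
(** When G / G' has order p^2 this is the kernel of the morphism from G to the
    cyclic group of order p that sends a and b to the same generator. *)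
Definition ker_ab (a b : gT) : {group gT} := <<ydiff a b>>%G.

Variables (a b : gT).
Hypotheses (ap : a ^+ p = 1) (bp : b ^+ p = 1).
Local Notation be := (psi_b a b ones).
Local Notation T := (psi_stab a b ones).
Local Notation y := (b * a^-1).
Local Notation Y := (ydiff a b).
Local Notation K := (ker_ab a b).
Let G := <<[set a; b]>>%G.

Lemma psi_b_onesE i k : be i k = if k == i then b else a.
Proof.
rewrite psi_bE; case: eqP => // /eqP ne; rewrite /ones subr_eq0 (negPf ne).
exact: expF1.
Qed.

Lemma mem_ydiff : y \in Y. Proof. exact: class_refl. Qed.
Lemma ydiffK : y \in K. Proof. by rewrite mem_gen // mem_ydiff. Qed.

Lemma ker_ab_sub : K \subset G.
Proof.
rewrite gen_subG; apply/subsetP=> _ /imsetP[g ag ->].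
have Gg : g \in G by apply: subsetP ag; rewrite cycle_subG gen2_l.
by rewrite groupJ // groupM ?groupV ?gen2_l ?gen2_r.
Qed.

Lemma ker_ab_norm : G \subset 'N(K).
Proof.
have na : a \in 'N(K).
  by apply: (subsetP (norms_gen (class_norm y <[a]>))); rewrite cycle_id.
rewrite gen_subG; apply/subsetP=> _ /set2P[]-> //.
by rewrite -[X in X \in _](mulgKV a b) groupM // (subsetP (normG _)) // ydiffK.
Qed.

Lemma norm_der_ker : G \subset 'N(K^`(1)).
Proof. exact: char_norm_trans (der_char 1 K) ker_ab_norm. Qed.

Lemma ker_ab_join : G \subset K <*> <[a]>.
Proof.
have Ka : a \in K <*> <[a]> by rewrite -cycle_subG joing_subr.
rewrite gen_subG; apply/subsetP=> _ /set2P[]-> //.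
by rewrite -[X in X \in _](mulgKV a b) groupM // (subsetP (joing_subl _ _)) // ydiffK.
Qed.

Lemma ones_proj (i : 'I_p) x : x \in G -> exists2 t : gTI, t \in T & t i = x.
Proof.
apply: psi_stab_proj => //.
by exists 1%R.
Qed.

Lemma psi_b_div (i j : 'I_p) : i != j -> be i * (be j)^-1 = emb i y * emb j y^-1.
Proof.
move=> ne; apply/ffunP=> k; rewrite !(mulg_ffun, invg_ffun) !embE !psi_b_onesE.
case: (eqVneq k i) => [->|_]; first by rewrite (negPf ne) mulg1.
by case: eqP => _; rewrite mul1g ?mulgV // invMg invgK.
Qed.

Lemma third_index (i j : 'I_p) : exists2 k, k != i & k != j.
Proof.
have /card_gt0P[k] : 0 < #|~: [set i; j]|.
  rewrite -subn_gt0 subn0 -(ltn_add2l #|[set i; j]|) addn0 cardsC card_ord cards2.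
  by case: (i == j); case: q p_odd.
by rewrite !inE negb_or => /andP[]; exists k.
Qed.

Lemma absorb_der (S : {group gTI}) : T \subset 'N(S) ->
    (forall i x x', x \in Y -> x' \in Y -> emb i [~ x, x'] \in S) ->
  pow K^`(1) \subset S.
Proof.
move=> nST YS; apply: pow_sub => i x; rewrite -mem_slice; apply/subsetP: x.
apply: der1_gen_sub; last by move=> x x' Yx Yx'; rewrite mem_slice YS.
apply: subset_trans (slice_norm ones_proj i nST).
exact: subset_trans (subset_gen _) ker_ab_sub.
Qed.

Section Absorb.
Variable (S : {group gTI}).
Hypothesis nST : T \subset 'N(S).
Hypothesis SB : forall i j : 'I_p, be i * (be j)^-1 \in S.

(** The conjugates of y by powers of a are reached by conjugating with a
    generator whose position k is neither i nor j, so that its coordinates at i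
    and j are both a. *)
Lemma absorb_ydiff (i j : 'I_p) x : i != j -> x \in Y -> emb i x * emb j x^-1 \in S.
Proof.
move=> ne /imsetP[_ /cycleP[n ->] ->]; have [k ki kj] := third_index i j.
have Sij := SB i j; rewrite psi_b_div // in Sij.
have := memJ_norm (emb i y * emb j y^-1) (subsetP nST _ (groupX n (mem_psi_b a b ones k))).
rewrite Sij conjMg !embJ !ffunX !psi_b_onesE [i == k]eq_sym [j == k]eq_sym.
by rewrite (negPf ki) (negPf kj) conjVg.
Qed.

(** Two antidiagonal pairs that share only coordinate i. *)
Lemma absorb_comm i x x' : x \in Y -> x' \in Y -> emb i [~ x, x'] \in S^`(1).
Proof.
move=> Yx Yx'; have [j ji _] := third_index i i; have [k ki kj] := third_index i j.
rewrite eq_sym in ji; rewrite eq_sym in ki.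
have := mem_commg (absorb_ydiff ji Yx) (absorb_ydiff ki Yx').
rewrite -[[~: _, _]]/(S^`(1)).
set u := [~ _, _]; suff -> : u = emb i [~ x, x'] by [].
apply/ffunP=> l; rewrite /u ffunR !mulg_ffun !embE.
case: (eqVneq l i) => [->|_]; first by rewrite (negPf ji) (negPf ki) !mulg1.
case: (eqVneq l j) => [->|_]; first by rewrite eq_sym (negPf kj) !mul1g commg1.
by case: eqP => _; rewrite !mul1g comm1g.
Qed.

Lemma absorb_antidiag : antidiag K K^`(1) \subset S.
Proof.
apply: (@antidiag_gen_sub 'I_p gT Y (K^`(1))%G S) => //.
  apply: absorb_der => // i x x' Yx Yx'.
  by apply: (subsetP (der_sub 1 S)); apply: absorb_comm.
exact: absorb_ydiff.
Qed.
End Absorb.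

Local Notation L := (antidiag_group K K^`(1) : {group gTI}).

Lemma psi_b_divL (i j : 'I_p) : be i * (be j)^-1 \in L.
Proof.
have [->|ne] := eqVneq i j; first by rewrite mulgV group1.
by rewrite psi_b_div // mem_antidiag // ydiffK.
Qed.

(** b = y a, and y acts trivially on K / K'. *)
Lemma coset_conj x g : x \in K -> g \in [set a; b] -> x ^ g * (x ^ a)^-1 \in K^`(1).
Proof.
move=> Kx /set2P[]->; first by rewrite mulgV group1.
have -> : x ^ b = (x ^ y) ^ a by rewrite -conjgM mulgKV.
rewrite -conjVg -conjMg memJ_norm ?(subsetP norm_der_ker) ?gen2_l //.
have -> : x ^ y * x^-1 = [~ x, y] ^ x^-1 by rewrite [RHS]conjgE conjg_mulR invgK -mulgA.
have nx : x^-1 \in 'N(K^`(1)) by rewrite groupV (subsetP (der_norm 1 K)).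
by rewrite memJ_norm // mem_commg // ydiffK.
Qed.

Let sDK : K^`(1) \subset K := der_sub 1 K.
Let nDK : K \subset 'N(K^`(1)) := der_norm 1 K.
Let abK : abelian (K / K^`(1)) := der_abelian 0 K.

Lemma psi_stab_norm_antidiag : T \subset 'N(L).
Proof.
rewrite gen_subG; apply/subsetP=> _ /imsetP[k _ ->].
have bi i : be k i \in [set a; b] by rewrite psi_b_onesE; case: eqP; rewrite !inE eqxx ?orbT.
have Gi i : be k i \in G by rewrite mem_gen.
apply: antidiag_norm => [i|i|i j x Kx].
- by rewrite (subsetP ker_ab_norm).
- by rewrite (subsetP norm_der_ker).
have := groupM (coset_conj Kx (bi i)) (groupVr (coset_conj Kx (bi j))).
by move: (x ^ a) (x ^ be k i) (x ^ be k j) => w u v; rewrite invMg invgK -mulgA mulKg.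
Qed.

Lemma card_antidiag_ker : (#|L| * #|K : K^`(1)| = #|K| ^ p)%N.
Proof. by have := card_antidiag sDK nDK abK (0%R : 'I_p); rewrite card_ord. Qed.

Lemma antidiag_ker_psi_stab : L \subset T.
Proof. by apply: absorb_antidiag => [|i j]; rewrite ?normG // groupM ?groupV ?mem_psi_b. Qed.

(** Modulo the antidiagonal group all generators of T coincide. *)
Lemma card_psi_stab_ones : be 0%R \notin L -> #|T| = (p * #|L|)%N.
Proof.
move=> nb; have sL := antidiag_ker_psi_stab.
rewrite -(Lagrange sL) mulnC; congr (_ * _)%N.
have nLb := subsetP psi_stab_norm_antidiag _ (mem_psi_b a b ones 0%R).
apply: (@index_join_cycle _ T L (be 0%R) p) => //.
- rewrite gen_subG; apply/subsetP=> _ /imsetP[i _ ->].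
  rewrite -(mulgKV (be 0%R) (be i)) groupM //; first by rewrite mem_gen // inE psi_b_divL.
  by rewrite mem_gen // inE cycle_id orbT.
- by rewrite (psi_b_exp _ ap bp) group1.
by apply: contra nb => /eqP<-; rewrite mem_psi_b.
Qed.

(** Up to K', the general tuple left invariant by the coordinate shift composed
    with conjugation by a, see [twist_invP]. *)
Definition twist_diag (x : gT) : gTI := [ffun k : 'I_p => x ^ (a ^- k)].

Lemma twist_diagM : {morph twist_diag : x x' / x * x'}.
Proof. by move=> x x'; apply/ffunP=> k; rewrite !ffunE conjMg. Qed.
Canonical twist_diag_morphism := @Morphism _ _ setT twist_diag (in2W twist_diagM).

Lemma twist_diag_inj : injective twist_diag.
Proof. by move=> x x' /ffunP/(_ 0%R); rewrite !ffunE !invg1 !conjg1. Qed.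

Lemma exp_a_norm n : a ^+ n \in 'N(K).
Proof. by rewrite groupX // (subsetP ker_ab_norm) // gen2_l. Qed.

(** The conjugates telescope, as y = b a^-1. *)
Lemma prod_ydiff n : \prod_(k < n) y ^ (a ^- k) = b ^+ n * a ^- n.
Proof.
elim: n => [|n IHn]; first by rewrite big_ord0 invg1 mulg1.
rewrite big_ord_recr /= IHn conjgE invgK !mulgA mulgKV.
by rewrite -(expgSr b) [a ^+ n.+1]expgSr invMg !mulgA.
Qed.

(** The product of the coordinates is the norm of x for the action of a. It is
    trivial on K / K': on the generators it telescopes to b^p = 1. In other
    words K / K' is a module over the ring of integers of the p-th cyclotomic
    field. *)
Lemma twist_diag_antidiag x : x \in K -> twist_diag x \in L.
Proof.
have gD : group_set [set x | twist_diag x \in L].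
  apply/group_setP; split=> [|u v]; first by rewrite inE (morph1 twist_diag_morphism) group1.
  by rewrite !inE twist_diagM; apply: groupM.
suff: K \subset Group gD by move/subsetP=> s /s; rewrite inE.
rewrite gen_subG; apply/subsetP=> {}x Yx; rewrite inE.
have Kx k : x ^ (a ^- k) \in K by rewrite memJ_norm ?groupV ?exp_a_norm // mem_gen.
rewrite [_ \in _](in_antidiag sDK nDK abK (0%R : 'I_p)).
apply/andP; split; first by apply/powP=> k; rewrite ffunE.
case/imsetP: Yx => _ /cycleP[n ->] ex.
have -> : \prod_i coset K^`(1) (twist_diag x i) = coset K^`(1) (\prod_(k < p) x ^ (a ^- k)).
  rewrite morph_prod => [|k _]; last by rewrite (subsetP nDK).
  by apply: eq_bigr => k _; rewrite ffunE.
have -> : \prod_(k < p) x ^ (a ^- k) = (\prod_(k < p) y ^ (a ^- k)) ^ (a ^+ n).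
  rewrite (big_morph (fun u => u ^ (a ^+ n)) (fun u v => conjMg u v _) (conj1g _)).
  apply: eq_bigr => k _; rewrite ex -!conjgM; congr (_ ^ _).
  by apply/commuteV/commuteX2.
by rewrite prod_ydiff ap bp invg1 mulg1 conj1g morph1.
Qed.

Definition twist_inv : {set gTI} := pow K^`(1) * (twist_diag @* K).

Lemma mem_twist_diag x (M : {group gT}) : G \subset 'N(M) -> (twist_diag x \in pow M) = (x \in M).
Proof.
move=> nM; have na n : a ^- n \in 'N(M) by rewrite groupV groupX // (subsetP nM) // gen2_l.
apply/powP/idP => [/(_ 0%R)|Mx k]; rewrite ffunE ?memJ_norm //.
Qed.

Lemma card_twist_inv : (#|twist_inv| * #|K^`(1)| = #|K^`(1)| ^ p * #|K|)%N.
Proof.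
have inj (M : {group gT}) : #|twist_diag @* M| = #|M|.
  by rewrite card_injm ?subsetT //; apply/injmP; apply: in2W; exact: twist_diag_inj.
have := mul_cardG (pow_group K^`(1)) (twist_diag @* K); rewrite /= card_pow card_ord inj => ->.
congr (_ * _)%N; rewrite -inj; congr #|pred_of_set _|.
apply/setP=> f; rewrite inE; apply/morphimP/andP => [[x _ Kx ->]|[Kf /morphimP[x _ Kx ef]]].
  split; first by rewrite [_ \in _](mem_twist_diag _ norm_der_ker).
  by rewrite mem_morphim ?in_setT // (subsetP sDK).
exists x; rewrite ?in_setT //; rewrite ef in Kf.
by move: Kf; rewrite [_ \in _](mem_twist_diag _ norm_der_ker).
Qed.

Lemma twist_inv_sub : twist_inv \subset L.
Proof.
apply: mul_subG; first exact: pow_antidiag.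
by apply/subsetP=> _ /morphimP[x _ Kx ->]; apply: twist_diag_antidiag.
Qed.

Lemma expS_ord (k : 'I_p) : a ^+ ((k + 1)%R : 'I_p) = a ^+ k.+1.
Proof. by rewrite /= expg_mod // modn_small // addn1. Qed.

Lemma twist_invP f : f \in pow K ->
  reflect (forall k : 'I_p, (f k)^-1 * (f (k + 1 : 'I_p)%R) ^ a \in K^`(1)) (f \in twist_inv).
Proof.
move=> /powP Kf; have nKa n : a ^+ n \in 'N(K^`(1)).
  by rewrite groupX // (subsetP norm_der_ker) // gen2_l.
have na : a \in 'N(K^`(1)) := nKa 1%N.
have nK x : x \in K -> x \in 'N(K^`(1)) by apply: subsetP.
apply: (iffP mulsgP) => [[z _ /powP Kz /morphimP[x _ Kx ->] ef] k|H].
  have ea : a ^- k.+1 * a = a ^- k by rewrite expgS invMg mulgKV.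
  rewrite ef !mulg_ffun !ffunE expS_ord conjMg -conjgM ea.
  have nx : x ^ a ^- k \in 'N(K^`(1)) by rewrite nK // memJ_norm // groupV exp_a_norm.
  have Kzk : (z k)^-1 * z (k + 1 : 'I_p)%R ^ a \in K^`(1) by rewrite groupM ?groupV ?memJ_norm.
  move: (x ^ _) nx (_ ^ a) Kzk => u nu v Kzv.
  have -> : (z k * u)^-1 * (v * u) = ((z k)^-1 * v) ^ u by rewrite conjgE invMg !mulgA.
  by rewrite memJ_norm.
exists (f * (twist_diag (f 0%R))^-1) (twist_diag (f 0%R)); last 2 first.
- by rewrite mem_morphim ?in_setT.
- by rewrite mulgKV.
(* the condition determines each coordinate from the previous one modulo K' *)
have step n : f (n%:R)%R * (f 0%R ^ (a ^- n))^-1 \in K^`(1).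
  elim: n => [|n IHn]; first by rewrite invg1 conjg1 mulgV group1.
  have Hn := H (n%:R)%R; rewrite -natr1 -(mulgKV (f (n%:R)%R ^ a^-1) (f (n%:R + 1)%R)) -mulgA.
  rewrite groupM //.
    have nu : (f (n%:R)%R ^ a^-1)^-1 \in 'N(K^`(1)) by rewrite groupV nK // memJ_norm // groupV (exp_a_norm 1).
    have : ((f n%:R%R)^-1 * f (n%:R + 1)%R ^ a) ^ a^-1 \in K^`(1) by rewrite memJ_norm ?groupV.
    rewrite conjMg conjVg conjgK -(memJ_norm _ nu).
    move: (_ ^ a^-1) (f (_ + _)%R) => u v; by rewrite conjgE invgK -mulgA mulKVg.
  have -> : a ^- n.+1 = a ^- n * a^-1 by rewrite expgS invMg.
  by rewrite conjgM -conjVg -conjMg memJ_norm ?groupV.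
by apply/powP=> k; rewrite mulg_ffun invg_ffun ffunE; have := step k; rewrite natr_Zp.
Qed.

Section NonAbelian.
Hypotheses (pG : p.-group G) (nabG : ~~ abelian G).

(** Otherwise y alone would generate G modulo G'. *)
Lemma ker_ab_neq : G != K.
Proof.
have nilG := pgroup_nil pG.
have Gy : y \in G by rewrite groupM ?groupV ?gen2_l ?gen2_r.
apply: contraNneq (nonabelian_join_cycle_der1 nilG nabG Gy) => eGK.
have sGK : G \subset K by rewrite eGK.
rewrite eqEsubset join_subG der_sub cycle_subG Gy; apply: subset_trans sGK _.
rewrite gen_subG; apply/subsetP=> _ /imsetP[g ag ->].
have Gg : g \in G by apply: subsetP ag; rewrite cycle_subG gen2_l.
rewrite conjg_mulR groupM //; first by rewrite mem_gen // inE cycle_id orbT.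
by rewrite mem_gen // inE mem_commg.
Qed.

Lemma index_ker_ab : #|G : K| = p.
Proof.
have na : a \in 'N(K) by rewrite (exp_a_norm 1).
apply: (@index_join_cycle _ G K a p) => //; last exact: ker_ab_neq.
- exact: ker_ab_sub.
- exact: ker_ab_join.
- by rewrite ap group1.
Qed.

Lemma psi_b0_antidiag : be 0%R \notin L.
Proof.
apply: contra ker_ab_neq => Lb.
have /powP/(_ 0%R) := subsetP (antidiag_sub_pow _ sDK) _ Lb.
rewrite psi_b_onesE eqxx => Kb.
have Ka : a \in K by rewrite -groupV -(groupMl _ Kb) ydiffK.
rewrite -val_eqE eqEsubset ker_ab_sub andbT /= gen_subG.
by apply/subsetP=> x /set2P[]->.
Qed.
End NonAbelian.

End ConstantLevel.

(** * From one level to the next *)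

Section Wreath.
Variable q : nat.
Local Notation p := q.+2.
Hypotheses (p_pr : prime p) (p_odd : odd p).
Variables (gT W : finGroupType).
Notation gTI := {dffun forall i : 'I_p, (fun=> gT) i}.
Local Notation pow A := (pow A : {set gTI}).
Local Notation antidiag M N := (antidiag M N : {set gTI}).
Variables (iota : gTI -> W) (A : W).
(** The effect on tuples of conjugation by the rooted automorphism a. *)
Definition shift (f : gTI) : gTI := [ffun k : 'I_p => f (k - 1 : 'I_p)%R].
Hypotheses (iotaM : {morph iota : f g / f * g}) (iota_inj : injective iota).
Hypotheses (oA : #[A] = p) (iotaJ : forall f, iota f ^ A = iota (shift f)).
Hypothesis (iotaA : forall n f, A ^+ n = iota f -> A ^+ n = 1).

Canonical iota_morphism := @Morphism _ _ setT iota (in2W iotaM).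

Lemma iota_mem f (S : {set gTI}) : (iota f \in iota @* S) = (f \in S).
Proof.
apply/morphimP/idP => [[g _ Sg /iota_inj->]//|Sf]; by exists f; rewrite ?in_setT.
Qed.
Lemma card_iota (S : {group gTI}) : #|iota @* S| = #|S|.
Proof. by rewrite card_injm ?subsetT //; apply/injmP; exact: in2W. Qed.

Lemma Ap : A ^+ p = 1. Proof. by rewrite -oA expg_order. Qed.

Variables (a b : gT) (E : 'I_p -> 'F_p) (i0 : 'I_p).
Hypotheses (ap : a ^+ p = 1) (bp : b ^+ p = 1) (E0 : E 0%R = 0%R).
Local Notation be := (psi_b a b E).
Local Notation T := (psi_stab a b E).
Local Notation B := (iota (be i0)).
Local Notation G := (<<[set a; b]>>%G : {group gT}).
Local Notation GW := (<<[set A; B]>>%G : {group W}).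

Lemma shift_psi_b i : shift (be i) = be (i + 1)%R.
Proof.
by apply/ffunP=> k; rewrite !ffunE subr_eq -addrA -opprD [(1 + i)%R]addrC.
Qed.

Lemma iota_psi_bJ n i : iota (be i) ^ (A ^+ n) = iota (be (i + n%:R)%R).
Proof.
elim: n => [|n IHn]; first by rewrite conjg1 addr0.
by rewrite expgSr conjgM IHn iotaJ shift_psi_b -addrA natr1.
Qed.

Lemma Bp : B ^+ p = 1.
Proof.
have e := psi_b_exp E ap bp i0.
have := morphX iota_morphism p (in_setT (be i0)); rewrite /= e => <-.
exact: (morph1 iota_morphism).
Qed.

Lemma iota_psi_b_mem i : iota (be i) \in GW.
Proof.
rewrite -(subrK i0 i) addrC -[(i - i0)%R]natr_Zp -iota_psi_bJ.
by rewrite groupJ ?groupX ?gen2_l ?gen2_r.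
Qed.

Lemma iota_psi_stab_sub : iota @* T \subset GW.
Proof.
rewrite morphim_gen ?subsetT // gen_subG; apply/subsetP=> _ /morphimP[_ _ /imsetP[i _ ->] ->].
exact: iota_psi_b_mem.
Qed.

Lemma A_norm_psi_stab : A \in 'N(iota @* T).
Proof.
rewrite morphim_gen ?subsetT //; apply: (subsetP (norm_gen _)).
rewrite inE; apply/subsetP=> _ /imsetP[_ /morphimP[_ _ /imsetP[i _ ->] ->] ->].
by rewrite /= iotaJ shift_psi_b mem_morphim ?in_setT // imset_f.
Qed.

Lemma gen_wreath : GW :=: iota @* T <*> <[A]>.
Proof.
apply/eqP; rewrite eqEsubset; apply/andP; split.
  rewrite gen_subG; apply/subsetP=> _ /set2P[]->; first by rewrite -cycle_subG joing_subr.
  by rewrite (subsetP (joing_subl _ _)) // iota_mem mem_psi_b.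
by rewrite join_subG iota_psi_stab_sub cycle_subG gen2_l.
Qed.

Lemma card_wreath : #|GW| = (p * #|T|)%N.
Proof.
rewrite gen_wreath norm_joinEr ?cycle_subG ?A_norm_psi_stab // TI_cardMg.
  by rewrite card_iota -orderE oA mulnC.
apply/trivgP/subsetP=> x /setIP[/morphimP[f _ _ ef] /cycleP[n en]].
by apply/set1P; rewrite en; apply: (iotaA (f := f)); rewrite -en ef.
Qed.

Lemma wreath_pgroup : p.-group G -> p.-group GW.
Proof.
move=> pG; rewrite /pgroup card_wreath pnatM pnat_id //=.
apply: pnat_dvd (cardSg (psi_stab_sub a b E)) _.
by rewrite /= card_pow card_ord pnatX [p.-nat _]pG.
Qed.

(** This carries the last hypothesis of [wreath_nonabelian] over to the next
    level. *)
Lemma wreath_cycle : B \in <[A]> -> B = 1.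
Proof. by move/cycleP=> [n en]; rewrite en; apply: (iotaA (f := be i0)); rewrite en. Qed.

(** If A and B commuted, the tuple [psi_b i0] would be invariant under the
    shift, hence constant, equal to b. Then b would be the power a^(E d), so b =
    1 by hypothesis and E d = 0. *)
Lemma wreath_nonabelian d : #[a] = p -> (b \in <[a]> -> b = 1) -> E d != 0%R -> ~~ abelian GW.
Proof.
move=> oa hb Ed; apply/negP=> abG; case/negP: Ed; apply/eqP.
have eB : be i0 = shift (be i0).
  apply: iota_inj; rewrite -iotaJ conjgE (centsP abG _ (gen2_r _ _) _ (gen2_l _ _)).
  by rewrite mulKg.
have cB n : be i0 (i0 + n%:R)%R = b.
  elim: n => [|n IHn]; first by rewrite addr0 psi_bE eqxx.
  by rewrite eB ffunE -natr1 addrA addrK.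
have bE k : be i0 k = b by rewrite -(subrK i0 k) addrC -[(k - i0)%R]natr_Zp cB.
have [d0|d0] := eqVneq d 0%R; first by rewrite d0.
have ed : b = a ^+ E d.
  rewrite -(bE (i0 + d)%R) psi_bE addrAC subrr add0r; case: eqP => // /eqP.
  by rewrite -subr_eq0 addrAC subrr add0r (negPf d0).
have b1 : b = 1 by apply: hb; rewrite ed mem_cycle.
have dv : p %| E d.
  by have := order_dvdn a (E d); rewrite -ed b1 eqxx oa.
have lt : E d < p by have := ltn_ord (E d); rewrite [X in _ < X -> _]Fp_cast.
apply/val_inj/eqP; rewrite /= -leqn0 leqNgt; apply/negP => gt0.
by rewrite gtnNdvd in dv.
Qed.
End Wreath.

(** * The conjugates of b a^-1 one level up *)

Section ConstantWreath.
Variable q : nat.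
Local Notation p := q.+2.
Hypotheses (p_pr : prime p) (p_odd : odd p).
Variables (gT W : finGroupType).
Notation gTI := {dffun forall i : 'I_p, (fun=> gT) i}.
Local Notation pow A := (pow A : {set gTI}).
Local Notation antidiag M N := (antidiag M N : {set gTI}).
Variables (iota : gTI -> W) (A : W).
Hypotheses (iotaM : {morph iota : f g / f * g}) (iota_inj : injective iota).
Hypotheses (oA : #[A] = p) (iotaJ : forall f, iota f ^ A = iota (shift f)).
Hypothesis (iotaA : forall n f, A ^+ n = iota f -> A ^+ n = 1).
Local Canonical iota_morphism' := @Morphism _ _ setT iota (in2W iotaM).

Variables (a b : gT) (i0 : 'I_p).
Hypotheses (ap : a ^+ p = 1) (bp : b ^+ p = 1).
Local Notation be := (psi_b a b (@ones q)).
Local Notation T := (psi_stab a b (@ones q)).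
Local Notation B := (iota (be i0)).
Local Notation G := (<<[set a; b]>>%G : {group gT}).
Local Notation GW := (<<[set A; B]>>%G : {group W}).
Local Notation K := (ker_ab a b).
Local Notation L := (antidiag_group K K^`(1) : {group gTI}).
Local Notation KW := (ker_ab A B).
Hypotheses (pG : p.-group G) (bL : be 0%R \notin L) (nabGW : ~~ abelian GW).

Let bJ := iota_psi_bJ iotaJ a b (@ones q).
(** K has index p at the upper level, and so has T. *)
Lemma card_kerW : #|KW| = (p * #|L|)%N.
Proof.
have pGW : p.-group GW by apply: (wreath_pgroup p_pr iotaM iota_inj oA iotaJ iotaA).
have := Lagrange (ker_ab_sub A B); rewrite (index_ker_ab p_pr (Ap oA)) // mulnC.
rewrite (card_wreath iotaM iota_inj oA iotaJ iotaA) => /eqP.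
by rewrite eqn_pmul2l // => /eqP->; apply: card_psi_stab_ones.
Qed.

Let iota_mem' := iota_mem iotaM iota_inj.

(** The effect on tuples of conjugation by the new y. *)
Definition unshift_conj (f : gTI) : gTI := [ffun k : 'I_p => f (k + 1 : 'I_p)%R ^ be i0 (k + 1 : 'I_p)%R].

Let iotaC f g : iota (f ^ g) = iota f ^ iota g := morphJ iota_morphism' (in_setT f) (in_setT g).
Let iotaV f : iota f^-1 = (iota f)^-1 := morphV iota_morphism' (in_setT f).

Lemma iotaY f : iota f ^ (B * A^-1) = iota (unshift_conj f).
Proof.
apply: (conjg_inj A); rewrite -conjgM mulgKV iotaJ.
rewrite -iotaC.
by congr (iota _); apply/ffunP=> k; rewrite !ffunE subrK.
Qed.

Definition iota_pre (X : {group W}) : {group gTI} := (iota_morphism' @*^-1 X)%G.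
Lemma mem_iota_pre (X : {group W}) f : (f \in iota_pre X) = (iota f \in X).
Proof. by apply/morphpreP/idP => [[]//|Tx]; split; rewrite ?in_setT. Qed.

Lemma iota_pre_norm (X : {group W}) : GW \subset 'N(X) -> T \subset 'N(iota_pre X).
Proof.
move=> nX; apply/subsetP=> t Tt; rewrite inE; apply/subsetP=> _ /imsetP[f Xf ->].
rewrite mem_iota_pre in Xf; rewrite mem_iota_pre iotaC memJ_norm // (subsetP nX) //.
apply: (subsetP (iota_psi_stab_sub iotaM iotaJ a b (@ones q) i0)).
by rewrite (iota_mem iotaM iota_inj).
Qed.

(** Modulo the upper K, all conjugates of B by powers of A coincide with A. *)
Lemma iota_pre_div (i j : 'I_p) : be i * (be j)^-1 \in iota_pre KW.
Proof.
rewrite mem_iota_pre iotaM iotaV.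
have e k : exists2 u, u \in KW & iota (be k) = u * A.
  exists ((B * A^-1) ^ (A ^+ (k - i0 : 'I_p)%R)).
    by apply: mem_gen; apply: memJ_class; apply: mem_cycle.
  rewrite conjMg bJ natr_Zp addrC subrK conjVg.
  have -> : A ^ (A ^+ (k - i0 : 'I_p)%R) = A by apply/conjg_fixP/commgP/commuteX.
  by rewrite mulgKV.
have [u Ku ->] := e i; have [v Kv ->] := e j.
by rewrite invMg mulgA mulgK groupM ?groupV.
Qed.

Let nKW := iota_pre_norm (ker_ab_norm A B).

Lemma antidiag_iota_pre : L \subset iota_pre KW.
Proof. by apply: (absorb_antidiag p_pr p_odd ap nKW) => i j; apply: iota_pre_div. Qed.

Lemma iota_L_sub : iota @* L \subset KW.
Proof. by apply/subsetP=> _ /morphimP[f _ Lf ->]; rewrite -mem_iota_pre (subsetP antidiag_iota_pre). Qed.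

(** The power of K' consists of commutators of antidiagonal pairs, which belong
    to the upper K. *)
Lemma iota_N_sub : iota @* pow K^`(1) \subset KW^`(1).
Proof.
have sP : iota @* iota_pre KW \subset KW.
  by apply/subsetP=> _ /morphimP[f _ Pf ->]; rewrite -mem_iota_pre.
apply: subset_trans (dergS 1 sP); rewrite -morphim_der ?subsetT // morphimS //.
apply: (absorb_der p_pr ap).
  exact: char_norm_trans (der_char 1 _) nKW.
by move=> i x x' Yx Yx'; apply: (absorb_comm p_odd nKW iota_pre_div).
Qed.

(** The conjugates of the new y differ from it by quotients of generators of T.
    *)
Lemma KW_join : KW :=: iota @* L <*> <[B * A^-1]>.
Proof.
apply/eqP; rewrite eqEsubset; apply/andP; split; last first.
  by rewrite join_subG iota_L_sub cycle_subG ydiffK.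
rewrite gen_subG; apply/subsetP=> _ /imsetP[_ /cycleP[n ->] ->].
have -> : (B * A^-1) ^ (A ^+ n) = iota (be (i0 + n%:R)%R * (be i0)^-1) * (B * A^-1).
  rewrite conjMg bJ conjVg.
  have -> : A ^ (A ^+ n) = A by apply/conjg_fixP/commgP/commuteX.
  by rewrite iotaM iotaV -!mulgA mulKg.
rewrite groupM //; last by rewrite -cycle_subG joing_subr.
by rewrite (subsetP (joing_subl _ _)) // iota_mem' psi_b_divL.
Qed.

Lemma shiftM : {morph @shift q gT : f g / f * g}.
Proof. by move=> f g; apply/ffunP=> k; rewrite !ffunE. Qed.
Local Canonical shift_morphism := @Morphism _ _ setT (@shift q gT) (in2W shiftM).

Lemma shift_pow (M : {group gT}) f : f \in pow M -> shift f \in pow M.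
Proof. by move/powP=> Mf; apply/powP=> k; rewrite ffunE. Qed.

Lemma shift_antidiag f : f \in L -> shift f \in L.
Proof.
have sL : L \subset (shift_morphism @*^-1 L)%G.
  apply: antidiag_sub.
    apply/subsetP=> g Kg; apply/morphpreP; rewrite in_setT; split=> //.
    by apply: (subsetP (@pow_antidiag 'I_p gT K (K^`(1))%G)); apply: (@shift_pow (K^`(1))%G).
  move=> i j x _ Kx; apply/morphpreP; rewrite in_setT; split=> //=.
  have e k u : shift (emb k u) = emb (k + 1 : 'I_p)%R u.
    by apply/ffunP=> l; rewrite [LHS]ffunE !embE subr_eq.
  by rewrite shiftM !e mem_antidiag.
by move/(subsetP sL)/morphpreP=> [].
Qed.

Lemma norm_iota (S : {group gTI}) : (forall f, f \in S -> shift f \in S) -> be i0 \in 'N(S) ->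
  B * A^-1 \in 'N(iota @* S).
Proof.
move=> sS nS; rewrite groupM ?groupV // inE; apply/subsetP=> _ /imsetP[_ /morphimP[f _ Sf ->] ->] /=.
  by rewrite -iotaC iota_mem' memJ_norm.
by rewrite iotaJ iota_mem' sS.
Qed.

(** The invariants of the new y: each coordinate of [psi_b i0] acts on K / K' as
    a does. *)
Lemma mem_iota_twist_inv l : (l \in [set iota f | f in twist_inv q a b]) =
  (l \in iota @* L) && ([~ l, B * A^-1] \in iota @* pow K^`(1)).
Proof.
have key f : f \in L -> (f \in twist_inv q a b) = ([~ iota f, B * A^-1] \in iota @* pow K^`(1)).
  move=> Lf; have Kf := subsetP (antidiag_sub_pow _ (der_sub 1 K)) _ Lf.
  have -> : [~ iota f, B * A^-1] = iota (f^-1 * unshift_conj f).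
    by rewrite iotaM iotaV -iotaY.
  rewrite iota_mem'.
  have e k : ((f k)^-1 * (f (k + 1 : 'I_p)%R) ^ a \in K^`(1)) = ((f^-1 * unshift_conj f) k \in K^`(1)).
    rewrite mulg_ffun invg_ffun ffunE; move/powP: Kf => Kf.
    have g : be i0 (k + 1 : 'I_p)%R \in [set a; b].
      by rewrite psi_b_onesE //; case: eqP; rewrite !inE eqxx ?orbT.
    have := coset_conj (Kf (k + 1 : 'I_p)%R) g.
    have := Kf k; move: (f k) (_ ^ be i0 _) (_ ^ a) => u v w Ku H.
    have nu : u \in 'N(K^`(1)) by rewrite (subsetP (der_norm 1 K)).
    have -> : u^-1 * v = (v * w^-1) ^ u * (u^-1 * w).
      by rewrite conjgE -!mulgA mulKVg mulVg mulg1.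
    by rewrite [RHS]groupMl ?memJ_norm.
  apply/(twist_invP ap Kf)/powP => H k; first by rewrite -e.
  by rewrite e.
apply/imsetP/andP => [[f If ->]|[/morphimP[f _ Lf ->] H]].
  by rewrite iota_mem' -key ?(subsetP (twist_inv_sub ap bp)).
by exists f => //; rewrite key.
Qed.

(** [card_coinvariants] applies to the antidiagonal group modulo the power of
    K', and the invariants have the order of K / K'. *)
Lemma index_kerW : #|KW : KW^`(1)| = (p * #|K : K^`(1)|)%N.
Proof.
have sN : pow K^`(1) \subset L by exact: pow_antidiag.
have nLN : L \subset 'N(pow K^`(1)).
  apply: subset_trans (antidiag_sub_pow _ (der_sub 1 K)) _.
  apply/subsetP=> f /powP Kf; apply: pow_norm => k; exact: (subsetP (der_norm 1 K)).
have abLN : abelian (iota @* L / iota @* pow K^`(1)).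
  apply: sub_der1_abelian; rewrite -morphim_der ?subsetT // morphimS //.
  rewrite gen_subG; apply/subsetP=> _ /imset2P[f g Lf Lg ->]; apply/powP=> k.
  have Kf h : h \in L -> h k \in K.
    by move/(subsetP (antidiag_sub_pow _ (der_sub 1 K)))/powP.
  by rewrite ffunR mem_commg ?Kf.
have nT := subsetP (psi_stab_norm_antidiag q a b) _ (mem_psi_b a b (@ones q) i0).
have nTN : be i0 \in 'N(pow K^`(1)).
  apply: pow_norm => k; rewrite (subsetP (norm_der_ker a b)) // mem_gen //.
  by rewrite psi_b_onesE //; case: eqP; rewrite !inE eqxx ?orbT.
have sNW : iota @* pow K^`(1) \subset (iota @* L <*> <[B * A^-1]>)^`(1).
  by rewrite -KW_join iota_N_sub.
have := @card_coinvariants _ (iota @* L)%G (iota @* pow_group K^`(1))%G (B * A^-1) _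
  (morphimS _ sN) (morphim_norms _ nLN) abLN (norm_iota shift_antidiag nT)
  (norm_iota (@shift_pow _) nTN) sNW mem_iota_twist_inv.
rewrite -KW_join !(card_iota iotaM iota_inj) card_imset //= card_pow card_ord => eC.
have eI := card_twist_inv q a b.
have KL := Lagrange (der_sub 1 K); have KWL := Lagrange (der_sub 1 KW).
have eI' : #|twist_inv q a b| = (#|K^`(1)| ^ p * #|K : K^`(1)|)%N.
  move/eqP: eI; rewrite -KL /= mulnA mulnAC eqn_pmul2r ?cardG_gt0 // => /eqP->.
  by [].
have eL : (#|KW^`(1)| * #|K : K^`(1)|)%N = #|L|.
  move/eqP: eC; rewrite eI' mulnCA mulnC eqn_pmul2r ?expn_gt0 ?cardG_gt0 // => /eqP.
  by [].
have /eqP := KWL; rewrite card_kerW -eL mulnCA eqn_pmul2l ?cardG_gt0 // => /eqP->.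
by [].
Qed.
End ConstantWreath.

(** * The first level and the rank of the circulant matrix *)

Section FirstLevel.
Variable q : nat.
Local Notation p := q.+2.
Hypotheses (p_pr : prime p) (p_odd : odd p).
Variable gT : finGroupType.
Notation gTI := {dffun forall i : 'I_p, (fun=> gT) i}.
Variables (a : gT) (E : 'I_p -> 'F_p).
Hypotheses (oa : #[a] = p) (E0 : E 0%R = 0%R).
Local Notation T := (psi_stab a 1 E).

Let ap : a ^+ p = 1. Proof. by rewrite -oa expg_order. Qed.

Definition expv (v : 'rV['F_p]_p) : gTI := [ffun k => a ^+ v 0%R k].

Lemma expvD v w : expv (v + w)%R = expv v * expv w.
Proof. by apply/ffunP=> k; rewrite !ffunE mxE expFD. Qed.

Lemma expvZ c v : expv (c *: v)%R = expv v ^+ c.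
Proof. by apply/ffunP=> k; rewrite ffunX !ffunE mxE mulrC expFM. Qed.

Lemma expF_inj (x y : 'F_p) : a ^+ x = a ^+ y -> x = y.
Proof.
move/eqP; rewrite eq_expg_mod_order oa !modn_small ?(leq_trans (ltn_ord _)) ?Fp_cast //.
by move/eqP/val_inj.
Qed.

Lemma expv_inj : injective expv.
Proof. by move=> v w /ffunP e; apply/rowP=> k; apply: expF_inj; have := e k; rewrite !ffunE. Qed.

Definition circ : 'M['F_p]_p := \matrix_(i, k) E (k - i)%R.

Lemma expv_circ i : expv (row i circ) = psi_b a 1 E i.
Proof.
by apply/ffunP=> k; rewrite !ffunE !mxE; case: eqP => // ->; rewrite subrr E0.
Qed.

(** At the first level b is trivial and the generators are the images of the
    rows of the circulant matrix under the exponential map from vectors to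
    tuples of powers of a. *)
Lemma psi_stab_rowg : T = [set expv v | v in rowg circ] :> {set gTI}.
Proof.
apply/eqP; rewrite eqEsubset; apply/andP; split.
  have gS : group_set [set expv v | v in rowg circ].
    apply/group_setP; split=> [|_ _ /imsetP[v Cv ->] /imsetP[w Cw ->]].
      apply/imsetP; exists 0%R; first by rewrite inE sub0mx.
      by apply/ffunP=> k; rewrite !ffunE mxE.
    by rewrite -expvD imset_f // inE addmx_sub // -mem_rowg.
  suff: T \subset Group gS by [].
  rewrite gen_subG.
  apply/subsetP=> _ /imsetP[i _ ->].
  by rewrite -expv_circ imset_f // inE row_sub.
apply/subsetP=> x /imsetP[v]; rewrite inE => /submxP[u ->] ->.
rewrite mulmx_sum_row; elim/big_rec: _ => [|i w _ Tw].
  suff -> : expv 0 = 1 by rewrite group1.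
  by apply/ffunP=> k; rewrite !ffunE mxE.
rewrite expvD groupM // expvZ groupX // expv_circ; exact: mem_psi_b.
Qed.

Lemma card_psi_stab_first : #|T| = (p ^ \rank circ)%N.
Proof. by rewrite psi_stab_rowg card_imset ?card_rowg ?card_Fp //; exact: expv_inj. Qed.

Local Notation K := (ker_ab a 1).

Lemma ker_ab_first : K = <[a]>%G.
Proof.
apply/val_inj; rewrite /= /ydiff mul1g.
have -> : a^-1 ^: <[a]> = [set a^-1].
  apply/setP=> x; rewrite inE; apply/imsetP/eqP => [[_ /cycleP[n ->] ->]|->].
    by apply/conjg_fixP/commgP/commuteX/commute_sym/commuteV.
  by exists 1; rewrite ?group1 ?conjg1.
by rewrite -[<<_>>]/<[a^-1]> cycleV.
Qed.

Lemma card_ker_first : #|K| = p.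
Proof. by rewrite ker_ab_first. Qed.

Lemma der_ker_first : K^`(1) = 1.
Proof. by rewrite ker_ab_first; apply/commG1P; apply: cycle_abelian. Qed.

(** The product of the coordinates is a^(p - 1), which is not trivial. *)
Lemma psi_b0_first : psi_b a 1 (@ones q) 0%R \notin antidiag_group (I := 'I_p) K K^`(1).
Proof.
apply/negP; rewrite [_ \in _](in_antidiag (der_sub 1 K) (der_norm 1 K) (der_abelian 0 K) (0%R : 'I_p)).
case/andP=> _ /eqP.
have constE (rT : finGroupType) (x : rT) n : \prod_(i < n) x = x ^+ n.
  by elim: n => [|n IHn]; rewrite ?big_ord0 // big_ord_recr /= IHn expgSr.
rewrite big_ord_recl psi_b_onesE // eqxx morph1 mul1g.
rewrite (eq_bigr (fun=> coset K^`(1) a)) => [|k _]; last by rewrite psi_b_onesE.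
have na : a \in 'N(K^`(1)) by rewrite der_ker_first norm1 in_setT.
rewrite constE -morphX // => /coset_idr; rewrite groupX // => /(_ isT).
move=> H; have {H}: a ^+ q.+1 \in K^`(1) := H.
by rewrite der_ker_first => /set1P/eqP; rewrite -order_dvdn oa gtnNdvd.
Qed.
End FirstLevel.

(** * Action of tree automorphisms on a level *)

Section Levels.
Variable p : nat.
Implicit Types (g h : tree_aut p) (n : nat).

Lemma size_aut g w : size (g w) = size w.
Proof.
elim/last_ind: w => [|w x IHw]; first by rewrite aut_root.
have: child (g w) (g (rcons w x)) by rewrite -aut_child; exists x.
by case=> y ->; rewrite !size_rcons IHw.
Qed.

Lemma size_aut_tuple g n (t : n.-tuple 'I_p) : size (g t) == n.
Proof. by rewrite size_aut size_tuple. Qed.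

Definition lev_fun n g (t : n.-tuple 'I_p) : n.-tuple 'I_p := Tuple (size_aut_tuple g t).

Lemma lev_inj n g : injective (@lev_fun n g).
Proof. by move=> s t /(congr1 val) /(can_inj (aut_funK g)) e; apply: val_inj. Qed.

Definition lev n g : {perm n.-tuple 'I_p} := perm (@lev_inj n g).

Lemma levE n g t : val (lev n g t) = g t.
Proof. by rewrite permE. Qed.

Lemma levM n g h : lev n (g * h) = lev n g * lev n h.
Proof. by apply/permP=> t; apply: val_inj; rewrite permM !levE. Qed.

Lemma lev1 n : lev n 1 = 1.
Proof. by apply/permP=> t; apply: val_inj; rewrite levE perm1. Qed.

Lemma levV n g : lev n g^-1 = (lev n g)^-1.
Proof. by apply: (mulgI (lev n g)); rewrite -levM !mulgV lev1. Qed.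

Lemma levX n g k : lev n (g ^+ k) = lev n g ^+ k.
Proof. by elim: k => [|k IHk]; rewrite ?lev1 // !expgS levM IHk. Qed.

Lemma lev_eqP n g h :
  reflect (forall w : word p, size w = n -> g w = h w) (lev n g == lev n h).
Proof.
apply: (iffP eqP) => [/permP e w sw|e].
  by have := congr1 val (e (Tuple (introT eqP sw))); rewrite !levE.
by apply/permP=> t; apply: val_inj; rewrite !levE e // size_tuple.
Qed.

Notation gT n := {perm n.-tuple 'I_p}.
Notation gTI n := {dffun forall i : 'I_p, (fun=> gT n) i}.

Definition iota_fun n (f : gTI n) (t : n.+1.-tuple 'I_p) : n.+1.-tuple 'I_p :=
  [tuple of thead t :: f (thead t) [tuple of behead t]].

Lemma iota_funE n (f : gTI n) (i : 'I_p) (t : n.-tuple 'I_p) : iota_fun f [tuple of i :: t] = [tuple of i :: f i t].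
Proof. by apply: val_inj; rewrite /= theadE; congr (_ :: val (f i _)); apply: val_inj. Qed.

Lemma iota_fun_inj n (f : gTI n) : injective (iota_fun f).
Proof.
move=> s t; case/tupleP: s => i s; case/tupleP: t => j t; rewrite !iota_funE.
by case/(congr1 val) => <- /val_inj/perm_inj->.
Qed.

(** The inverse of psi at finite level. *)
Definition iotap n (f : gTI n) : gT n.+1 := perm (@iota_fun_inj n f).

Lemma iotapE n (f : gTI n) (i : 'I_p) (t : n.-tuple 'I_p) : iotap f [tuple of i :: t] = [tuple of i :: f i t].
Proof. by rewrite permE iota_funE. Qed.

Lemma iotapM n : {morph @iotap n : f g / f * g}.
Proof.
move=> f g; apply/permP=> t; case/tupleP: t => i t.
by rewrite permM !iotapE mulg_ffun permM.
Qed.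

Lemma iotap_inj n : injective (@iotap n).
Proof.
move=> f g /permP e; apply/ffunP=> i; apply/permP=> t.
have := e [tuple of i :: t]; rewrite !iotapE => /(congr1 val)[] /val_inj.
by [].
Qed.
End Levels.

Section RingLevels.
Variable q : nat.
Local Notation p := q.+2.
Hypotheses (p_pr : prime p).
Notation gT n := {perm n.-tuple 'I_p}.
Notation gTI n := {dffun forall i : 'I_p, (fun=> gT n) i}.
Local Notation A n := (lev n (ggs_a p)).

Lemma lev_aE n (i : 'I_p) (t : n.-tuple 'I_p) : A n.+1 [tuple of i :: t] = [tuple of (i + 1)%R :: t].
Proof.
apply: val_inj; rewrite levE /=; congr (_ :: _); apply: val_inj => /=.
by rewrite modnDmr addn1.
Qed.

Lemma lev_aXE n k (i : 'I_p) (t : n.-tuple 'I_p) :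
  (A n.+1 ^+ k) [tuple of i :: t] = [tuple of (i + k%:R)%R :: t].
Proof.
elim: k => [|k IHk]; first by rewrite perm1; apply: val_inj; rewrite /= addr0.
by rewrite expgSr permM IHk lev_aE; apply: val_inj; rewrite /= -addrA natr1.
Qed.

Lemma natr_ord_eq0 k : ((k%:R : 'I_p) == 0)%R = (p %| k).
Proof. by rewrite -val_eqE Zp_nat /=. Qed.

Lemma lev_a_fix n k f : A n.+1 ^+ k = iotap (n := n) f -> A n.+1 ^+ k = 1.
Proof.
move=> e; apply/permP=> t; case/tupleP: t => i t.
have := congr1 (fun s : gT n.+1 => s [tuple of i :: t]) e.
rewrite iotapE lev_aXE perm1 => /(congr1 val)[] /= e1 _.
apply: val_inj; congr (_ :: _); exact: e1.
Qed.

Lemma lev_a_exp n : A n ^+ p = 1.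
Proof.
case: n => [|n].
  by apply/permP=> t; exact: etrans (tuple0 _) (esym (tuple0 _)).
apply/permP=> t; case/tupleP: t => i t; rewrite lev_aXE perm1.
have /eqP e : ((p%:R : 'I_p) == 0)%R by rewrite natr_ord_eq0.
by apply: val_inj; rewrite /= e addr0.
Qed.

Lemma order_lev_a n : #[A n.+1] = p.
Proof.
apply: nt_prime_order => //; first exact: lev_a_exp.
apply/eqP=> /permP/(_ [tuple of 0%R :: [tuple 0%R | i < n]]); rewrite perm1 lev_aE.
by case/(congr1 val).
Qed.

Lemma iotapJ n (f : gTI n) : iotap f ^ A n.+1 = iotap (shift f).
Proof.
apply: (mulgI (A n.+1)); rewrite conjgE mulKVg.
apply/permP=> t; case/tupleP: t => i t; rewrite !permM iotapE !lev_aE iotapE.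
by rewrite ffunE addrK.
Qed.

Variable (e : 'rV['F_p]_q.+1).
(** Indexing by all residues modulo p turns symmetry into E (- c) = E c, and the
    conjugates of b into translates of one vector. *)
Definition evec (d : 'I_p) : 'F_p := if unlift ord0 d is Some j then e 0%R j else 0%R.

Lemma evec0 : evec 0%R = 0%R.
Proof. by rewrite /evec unlift_none. Qed.

Lemma evec_lift j : evec (lift ord0 j) = e 0%R j.
Proof. by rewrite /evec liftK. Qed.

(** The vector (e, 0) starts at residue 1, hence the shift by one. *)
Lemma append0E k : append0 e 0%R k = evec (k + 1)%R.
Proof.
rewrite mxE; case: unliftP => [j ->|->].
  rewrite -evec_lift; congr evec; apply: val_inj => /=.
  have jl := ltn_ord j.
  by rewrite /bump leq0n [q < j]leqNgt jl add0n modnDmr addn1 modn_small // add1n.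
suff -> : (ord_max + 1 = 0 :> 'I_p)%R by rewrite evec0.
by apply: val_inj; rewrite /= modnDmr addn1 modnn.
Qed.

(** The letter of [ord_max] is the residue -1, so that the letter j of the
    recursive definition of b corresponds to the residue j + 1. *)
Lemma lev_bE n : lev n.+1 (ggs_b e) =
  iotap (psi_b (A n) (lev n (ggs_b e)) evec ord_max).
Proof.
apply/permP=> t; case/tupleP: t => i t; rewrite iotapE; apply: val_inj.
rewrite levE /= psi_bE; congr (_ :: _); case: insubP => [j _ ej|].
  have ij : i != ord_max by rewrite -val_eqE /= -ej; apply: (negbT (ltn_eqF (ltn_ord j))).
  rewrite (negPf ij) -levX levE.
  have -> : (i - ord_max = lift ord0 j :> 'I_p)%R.
    apply/eqP; rewrite subr_eq; apply/eqP; apply: val_inj; rewrite /= -ej.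
    have jl := ltn_ord j.
    by rewrite /bump leq0n add1n addSnnS modnDr modn_small // ltnW.
  by rewrite evec_lift.
rewrite -leqNgt => le; have -> : i = ord_max.
  by apply: val_inj; apply/eqP; rewrite eqn_leq le -ltnS ltn_ord.
by rewrite eqxx levE.
Qed.
End RingLevels.

(** * Recurrences for the orders of the congruence quotients *)

Lemma logn_pow_mul (p m : nat) : prime p -> 0 < m ->
  logn p (p ^ p * m ^ p) = (p * (logn p m).+1)%N.
Proof.
move=> p_pr m0; rewrite lognM ?expn_gt0 ?m0 ?prime_gt0 // pfactorK // lognX.
by rewrite mulnS.
Qed.

Lemma lognMp (p m : nat) : prime p -> 0 < m -> logn p (p * m) = (logn p m).+1.
Proof. by move=> p_pr m0; rewrite (lognM p (prime_gt0 p_pr) m0) (logn_prime p p_pr) eqxx. Qed.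

Section Tower.
Variable q : nat.
Local Notation p := q.+2.
Hypotheses (p_pr : prime p) (p_odd : odd p).
Notation gT n := {perm n.-tuple 'I_p}.
Local Notation A n := (lev n (ggs_a p)).
Variables (E : 'I_p -> 'F_p) (b : forall n, gT n).
Hypotheses (E0 : E 0%R = 0%R).
Hypothesis bS : forall n, b n.+1 = iotap (psi_b (A n) (b n) E ord_max).
Local Notation G n := (<<[set A n; b n]>>%G : {group gT n}).
Local Notation T n := (psi_stab (A n) (b n) E).

Lemma perm0tuple (s t : gT 0) : s = t.
Proof. by apply/permP=> u; exact: etrans (tuple0 _) (esym (tuple0 _)). Qed.

Lemma b_exp n : b n ^+ p = 1.
Proof.
elim: n => [|n IHn]; first exact: perm0tuple.
by rewrite bS; apply: Bp => //; [exact: iotapM | exact: lev_a_exp].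
Qed.

Lemma b1 : b 1 = 1.
Proof.
rewrite bS; apply/permP=> t; case/tupleP: t => i t; rewrite iotapE perm1.
by rewrite (perm0tuple (psi_b _ _ _ _ _) 1) perm1.
Qed.

Lemma card_level n : #|G n.+1| = (p * #|T n|)%N.
Proof.
rewrite bS; apply: card_wreath.
- exact: iotapM.
- exact: iotap_inj.
- exact: order_lev_a.
- exact: iotapJ.
- exact: lev_a_fix.
Qed.

Lemma level_pgroup n : p.-group (G n).
Proof.
elim: n => [|n IHn].
  have -> : G 0 = 1%G by apply/val_inj/trivgP/subsetP=> s _; apply/set1P/perm0tuple.
  exact: pgroup1.
rewrite bS; apply: wreath_pgroup => //.
- exact: iotapM.
- exact: iotap_inj.
- exact: order_lev_a.
- exact: iotapJ.
- exact: lev_a_fix.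
Qed.

Lemma b_cycle n : b n.+1 \in <[A n.+1]> -> b n.+1 = 1.
Proof. by rewrite bS; apply: wreath_cycle; apply: lev_a_fix. Qed.

Lemma level_nonabelian d n : E d != 0%R -> ~~ abelian (G n.+2).
Proof.
move=> Ed; rewrite bS.
exact: (wreath_nonabelian p_pr (@iotap_inj p n.+1) (@iotapJ q n.+1) _ E0
          (order_lev_a p_pr n) (@b_cycle n) Ed).
Qed.

(** The exponents start at level 2, the first one at which the quotient is not
    abelian. *)
Definition expo n := logn p #|G n.+2|.

Lemma card_expo n : #|G n.+2| = (p ^ expo n)%N.
Proof. exact: card_pgroup (level_pgroup _). Qed.

Lemma expo0 : expo 0 = (\rank (circ E)).+1.
Proof.
rewrite /expo card_level b1 (card_psi_stab_first p_pr) ?(order_lev_a p_pr) //.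
by rewrite -expnS pfactorK.
Qed.

Section NonTrivial.
Variables (d : 'I_p).
Hypothesis Ed : E d != 0%R.

Lemma expo_der n : expo n = (logn p #|(G n.+2)^`(1)|).+2.
Proof.
have nilG := pgroup_nil (level_pgroup n.+2).
rewrite /expo -(Lagrange (der_sub 1 (G n.+2))).
rewrite (index_der1_gen2 p_pr (lev_a_exp q _) (b_exp _) nilG (level_nonabelian n Ed)).
by rewrite lognM ?cardG_gt0 ?expn_gt0 // pfactorK // addn2.
Qed.

Lemma expo_asym c n : E c != E (- c)%R -> expo n.+1 = (1 + p * (expo n).-1)%N.
Proof.
move=> asymE; rewrite (expo_der n) /= /expo card_level.
rewrite (card_psi_stab_asym p_pr (lev_a_exp q _) (b_exp _) E0 (level_pgroup _) (level_nonabelian n Ed) asymE).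
have m0 : 0 < #|(G n.+2)^`(1)| := cardG_gt0 _.
rewrite (lognMp p_pr); last by rewrite muln_gt0 !expn_gt0 m0.
by rewrite (logn_pow_mul p_pr m0).
Qed.

Lemma expo_sym c n : (forall c, E (- c)%R = E c) -> c != 0%R -> E c != E d ->
  expo n.+1 = (p * (expo n).-1)%N.
Proof.
move=> symE c0 Ec; rewrite (expo_der n) /= /expo card_level.
have := card_psi_stab_sym p_pr p_odd (lev_a_exp q _) (b_exp _) E0 (level_pgroup _) (level_nonabelian n Ed) symE Ed c0 Ec.
move/(congr1 (logn p)); rewrite (logn_pow_mul p_pr) ?cardG_gt0 // mulnC => <-.
by [].
Qed.
End NonTrivial.
End Tower.

Section ConstantTower.
Variable q : nat.
Local Notation p := q.+2.
Hypotheses (p_pr : prime p) (p_odd : odd p).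
Notation gT n := {perm n.-tuple 'I_p}.
Local Notation A n := (lev n (ggs_a p)).
Variables (b : forall n, gT n).
Hypothesis bS : forall n, b n.+1 = iotap (psi_b (A n) (b n) (@ones q) ord_max).
Local Notation G n := (<<[set A n; b n]>>%G : {group gT n}).
Local Notation K n := (ker_ab (A n) (b n)).

Lemma ones0 : @ones q 0%R = 0%R. Proof. by rewrite /ones eqxx. Qed.
Lemma ones1 : @ones q 1%R != 0%R. Proof. by []. Qed.

Lemma psi_b0_level n : psi_b (A n.+1) (b n.+1) (@ones q) 0%R \notin
  antidiag_group (I := 'I_p) (K n.+1) (K n.+1)^`(1).
Proof.
case: n => [|n]; last first.
  exact: (psi_b0_antidiag (level_pgroup p_pr bS _) (level_nonabelian p_pr ones0 bS n ones1)).
rewrite (b1 bS); apply: psi_b0_first => //; exact: order_lev_a.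
Qed.

Let nab n := level_nonabelian p_pr ones0 bS n ones1.
Let ap n := lev_a_exp q n.
Let bp n := b_exp bS n.

Lemma index_ker_level n : #|K n.+1 : (K n.+1)^`(1)| = (p ^ n.+1)%N.
Proof.
elim: n => [|n IHn].
  by rewrite (b1 bS) (der_ker_first _) indexg1 (card_ker_first (order_lev_a p_pr 0)).
rewrite expnS -IHn [in LHS]bS.
apply: (index_kerW p_pr p_odd (@iotapM _ _) (@iotap_inj _ _) (order_lev_a p_pr _) (@iotapJ q _)
   (@lev_a_fix q _) (ap _) (bp _) (level_pgroup p_pr bS _) (psi_b0_level _)).
by rewrite -bS; exact: nab.
Qed.

Lemma card_ker_level n :
  (#|K n.+2| * p ^ n.+1 = p * #|K n.+1| ^ p)%N.
Proof.
have := card_antidiag_ker q (A n.+1) (b n.+1); rewrite index_ker_level => <-.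
rewrite mulnA; congr (_ * _)%N; rewrite bS.
apply: (card_kerW p_pr p_odd (@iotapM _ _) (@iotap_inj _ _) (order_lev_a p_pr _) (@iotapJ q _)
   (@lev_a_fix q _) (ap _) (bp _) (level_pgroup p_pr bS _) (psi_b0_level _)).
by rewrite -bS; exact: nab.
Qed.

(** Unlike [expo], this starts at level 1, where K is the group generated by a.
    *)
Definition kexpo n := logn p #|K n.+1|.

Lemma kexpo0 : kexpo 0 = 1%N.
Proof. by rewrite /kexpo (b1 bS) (card_ker_first (order_lev_a p_pr 0)) logn_prime // eqxx. Qed.

Lemma kexpoS n : (kexpo n.+1 + n.+1 = (p * kexpo n).+1)%N.
Proof.
have := congr1 (logn p) (card_ker_level n).
by rewrite (lognMp p_pr) ?expn_gt0 ?cardG_gt0 // lognX lognM ?expn_gt0 ?cardG_gt0 // pfactorK.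
Qed.

Lemma expo_kexpo n : expo b n = (kexpo n.+1).+1.
Proof.
rewrite /expo -(Lagrange (ker_ab_sub _ _)).
rewrite (index_ker_ab p_pr (ap _) (level_pgroup p_pr bS _) (nab n)) mulnC (lognMp p_pr) //.
Qed.
End ConstantTower.

(** * Congruence quotients as permutation groups *)

Import finmap boolp classical_sets functions cardinality.

Section Congruence.
Variables (p : nat) (e : 'rV['F_p]_p.-1) (n : nat).
Local Open Scope classical_set_scope.
Local Notation GG := (GGS e).
Local Notation Gn := (<<[set lev n (ggs_a p); lev n (ggs_b e)]%SET>>%G).

Lemma GGS_closed : group_closed (mem GG).
Proof.
have cl (H : set (tree_aut p)) : group_closed (mem H) -> H 1 /\ forall g h, H g -> H h -> H (g * h^-1).
  move=> cH; split; first by have := cH.1; rewrite inE.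
  by move=> g h Hg Hh; have := cH.2 g h; rewrite !inE; apply.
split=> [|g h]; rewrite !inE; first by move=> H [/cl[]].
move=> Gg Gh H HG; have [cH _] := HG; apply: (cl H cH).2; [exact: Gg | exact: Gh].
Qed.

Lemma GGS_a : GG (ggs_a p).
Proof. by move=> H [_ sH]; apply: sH; left. Qed.

Lemma GGS_b : GG (ggs_b e).
Proof. by move=> H [_ sH]; apply: sH; right. Qed.

Lemma lev_GGS g : GG g -> lev n g \in Gn.
Proof.
apply: (_ : GG `<=` [set g | lev n g \in Gn]).
apply: smallest_sub => [|_ [->|->]] /=; last 2 first.
- exact: gen2_l.
- exact: gen2_r.
split; first by rewrite inE /= lev1 group1.
by move=> f h; rewrite !inE /= levM levV => Gf Gh; rewrite groupM ?groupV.
Qed.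

Lemma lev_GGS_surj s : s \in Gn -> exists2 g, GG g & lev n g = s.
Proof.
pose X := [set s | `[< exists2 g, GG g & lev n g = s >]]%SET.
have [G1 GV] := GGS_closed.
have gX : group_set X.
  apply/group_setP; split=> [|s1 s2].
    by rewrite finset.in_set; apply/asboolP; exists 1; rewrite ?lev1 //; rewrite inE in G1.
  rewrite !finset.in_set => /asboolP[g Gg <-] /asboolP[h Gh <-]; apply/asboolP.
  exists (g * h); last by rewrite levM.
  by have := group_closedM GGS_closed; move/(_ g h); rewrite !inE; apply.
suff: Gn \subset Group gX by move/fintype.subsetP=> sX /sX; rewrite finset.in_set => /asboolP.
rewrite gen_subG; apply/fintype.subsetP=> _ /set2P[]->; rewrite finset.in_set; apply/asboolP.
  by exists (ggs_a p) => //; exact: GGS_a.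
by exists (ggs_b e) => //; exact: GGS_b.
Qed.

Definition lev_fiber (s : {perm n.-tuple 'I_p}) : set (tree_aut p) := [set g | GG g /\ lev n g = s].

Lemma coset_fiber g : GG g -> [set g * h | h in @Stab p n `&` GG] = lev_fiber (lev n g).
Proof.
move=> Gg; apply/seteqP; split=> [_ [h [Sh Gh] <-]|g' [Gg' eg']].
  split; first by have := group_closedM GGS_closed; move/(_ g h); rewrite !inE; apply.
  rewrite levM; suff -> : lev n h = 1 by rewrite mulg1.
  by rewrite -(lev1 p n); apply/eqP/lev_eqP => w /Sh.
have Gh : GG (g^-1 * g').
  have := group_closedM GGS_closed; move/(_ g^-1 g'); rewrite !inE; apply=> //.
  by have := group_closedV GGS_closed; move/(_ g); rewrite !inE; apply.
exists (g^-1 * g'); last by rewrite mulKVg.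
split=> // w sw; have := @lev_eqP p n (g^-1 * g') 1.
by rewrite levM levV eg' mulVg lev1 eqxx => /elimT/(_ isT)/(_ _ sw).
Qed.

Lemma congruence_quotientE : congruence_quotient GG n = lev_fiber @` [set` Gn].
Proof.
apply/seteqP; split=> [_ [g Gg <-]|_ [s Gs <-]].
  by rewrite coset_fiber //; exists (lev n g) => //; exact: lev_GGS.
by have [g Gg <-] := lev_GGS_surj Gs; exists g => //; rewrite coset_fiber.
Qed.

Lemma finite_congruence_quotient : finite_set (congruence_quotient GG n).
Proof. by rewrite congruence_quotientE; apply: finite_image; exact: finite_finset. Qed.

Lemma card_congruence_quotient :
  #|` fset_set (congruence_quotient GG n)|%fset = #|Gn|.
Proof.
rewrite congruence_quotientE fset_set_image; last exact: finite_finset.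
have -> : fset_set [set` Gn] = [fset s in Gn]%fset.
  apply/fsetP=> s; rewrite in_fset_set; last exact: finite_finset.
  by rewrite in_fset; apply/idP/idP; rewrite inE.
rewrite card_in_imfset /=; first by rewrite card_imfset //= -cardE.
move=> s1 s2; rewrite !inE => /lev_GGS_surj[g Gg <-] _ es.
by have [_ <-] : lev_fiber s2 g by rewrite -es.
Qed.
End Congruence.

(** * The defining vector *)

Import reals exp Order.TTheory Num.Theory.
Local Open Scope ring_scope.

Section DefiningVector.
Variable q : nat.
Local Notation p := q.+2.
Hypotheses (p_pr : prime p) (p_odd : odd p).
Variable e : 'rV['F_p]_q.+1.
Local Notation E := (evec e).

Lemma rank_circulant : \rank (circulant (append0 e)) = \rank (circ E).
Proof.
have rE i : row i (circulant (append0 e)) = row (i - 1) (circ E).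
  by apply/rowP=> k; rewrite [LHS]mxE [LHS]mxE append0E !mxE opprB addrA addrAC.
apply/eqP; rewrite eqn_leq; apply/andP; split; apply: mxrankS; apply/row_subP=> i.
  by rewrite rE row_sub.
by rewrite -[i](addrK 1) -rE row_sub.
Qed.

Lemma oppr_lift (i : 'I_q.+1) : - lift ord0 i = lift ord0 (rev_ord i) :> 'I_p.
Proof.
apply/val_inj; rewrite /= /bump !leq0n !add1n /= !subSS modn_small.
  by rewrite subSn // -ltnS.
by rewrite ltnS leq_subr.
Qed.

Lemma symmetric_vecP : symmetric_vec e -> forall c, E (- c) = E c.
Proof.
move/forallP=> sym c; case: (unliftP ord0 c) => [i ->|->]; last by rewrite oppr0.
by rewrite oppr_lift !evec_lift; apply/eqP; rewrite eq_sym.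
Qed.

Lemma asymmetric_vecP : ~~ symmetric_vec e -> exists c, E c != E (- c).
Proof.
rewrite negb_forall => /existsP[i ne]; exists (lift ord0 i).
by rewrite oppr_lift !evec_lift.
Qed.

Lemma nonzero_vecP : e != 0 -> exists2 d, d != 0 & E d != 0.
Proof.
move=> nz; have [i ei|none] := pickP (fun i => e 0 i != 0).
  by exists (lift ord0 i); rewrite ?evec_lift.
by case/eqP: nz; apply/rowP=> i; rewrite mxE; apply/eqP/negbFE/none.
Qed.

Lemma nonconstant_vecP d : d != 0 -> ~~ constant_vec e ->
  exists2 c, c != 0 & E c != E d.
Proof.
move=> d0; rewrite negb_forall => /existsP[i]; rewrite negb_forall => /existsP[j ne].
have [eid|] := eqVneq (E (lift ord0 i)) (E d); last by exists (lift ord0 i).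
by exists (lift ord0 j); rewrite // -eid !evec_lift eq_sym.
Qed.

Lemma constant_vec_sym : constant_vec e -> symmetric_vec e.
Proof. by move/forallP=> c; apply/forallP=> i; have /forallP := c i; apply. Qed.

Lemma constant_vecP d : d != 0 -> constant_vec e -> forall c, c != 0 -> E c = E d.
Proof.
move=> d0 /forallP con c c0.
case: (unliftP ord0 c) c0 => [i ->|->]; last by rewrite eqxx.
case: (unliftP ord0 d) d0 => [j ->|->]; last by rewrite eqxx.
by move=> _ _; rewrite !evec_lift; have /forallP/(_ j)/eqP := con i.
Qed.

Notation gT n := {perm n.-tuple 'I_p}.
(** When the entries of e all equal c and k is the inverse of c modulo p, the
    power b^k satisfies the recursion of the vector of ones. *)
Definition bpow (k : 'F_p) n : gT n := (lev n (ggs_b e) ^+ k)%g.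

Lemma bpowS (k : 'F_p) d n : E d != 0 -> k = (E d)^-1 -> (forall c, c != 0 -> E c = E d) ->
  bpow k n.+1 = iotap (psi_b (lev n (ggs_a p)) (bpow k n) (@ones q) ord_max).
Proof.
move=> Ed ek con.
pose f := Morphism (D := [set: {dffun forall i : 'I_p, (fun=> gT n) i}]%SET) (in2W (@iotapM p n)).
rewrite /bpow lev_bE -[LHS](morphX f) ?finset.in_setT //=.
congr iotap; apply/ffunP=> i; rewrite ffunX psi_b_onesE // psi_bE; case: eqP => // /eqP ne.
by rewrite con ?subr_eq0 // ek (expF_cancel p_pr) // lev_a_exp.
Qed.

(** b is a power of b^k. *)
Lemma bpow_expo (k : 'F_p) n : k != 0 -> expo (bpow k) n = expo (fun n => lev n (ggs_b e)) n.
Proof.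
move=> k0; rewrite /expo; congr (logn _ #|pred_of_set _|).
have bp := b_exp (lev_bE e) n.+2.
have ek := expF_cancel p_pr bp k0.
apply/eqP; rewrite finset.eqEsubset !gen_subG; apply/andP; split.
  apply/fintype.subsetP=> _ /set2P[]->; first exact: gen2_l.
  by rewrite groupX ?gen2_r.
apply/fintype.subsetP=> _ /set2P[]->; first exact: gen2_l.
by rewrite -[X in X \in _]ek groupX ?gen2_r.
Qed.
End DefiningVector.

(** * The order formula *)

Section Orders.
Variable R : realType.
Variable q : nat.
Local Notation p := q.+2.
Hypotheses (p_pr : prime p) (p_odd : odd p).
Variable e : 'rV['F_p]_q.+1.
Hypothesis e_neq0 : e != 0.
Local Notation E := (evec e).
Local Notation b n := (lev n (ggs_b e)).
Local Notation P := (p%:R : R).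

Let bS := lev_bE e.
Let E0 : E 0 = 0 := evec0 e.
Local Notation t := (\rank (circulant (append0 e))).
Local Notation x := (expo (fun n => lev n (ggs_b e))).

Let P1 : P - 1 != 0.
Proof. by rewrite subr_eq0 -[1]/(1%:R) eqr_nat. Qed.

Lemma log_order n : log P (#|<<[set lev n.+2 (ggs_a p); b n.+2]%SET>>%G|%:R) = (x n)%:R :> R.
Proof.
rewrite (card_expo p_pr bS) natrX /log lnXn ?ltr0n // -[ln _ *+ _]mulr_natl mulfK //.
by rewrite gt_eqF // ln_gt0 // ltr1n.
Qed.

Lemma expo_init : x 0%N = t.+1.
Proof. by rewrite (expo0 p_pr E0 bS) rank_circulant. Qed.

Lemma expo_pred n : (x n).-1%:R = (x n)%:R - 1 :> R.
Proof.
have [d d0 Ed] := nonzero_vecP e_neq0.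
by rewrite (expo_der p_pr E0 bS Ed) -natr1 addrK.
Qed.

Lemma asymmetric_order n : ~~ symmetric_vec e -> (x n)%:R = t%:R * P ^+ n + 1.
Proof.
move=> asym; have [c Ec] := asymmetric_vecP asym.
have [d d0 Ed] := nonzero_vecP e_neq0.
elim: n => [|n IHn]; first by rewrite expo_init expr0 mulr1 natr1.
rewrite (expo_asym p_pr E0 bS Ed n Ec) natrD natrM expo_pred IHn addrK exprS.
by ring.
Qed.

Lemma symmetric_order n : symmetric_vec e -> ~~ constant_vec e ->
  (x n)%:R = t%:R * P ^+ n + 1 - (P ^+ n - 1) / (P - 1).
Proof.
move=> sym ncon; have [d d0 Ed] := nonzero_vecP e_neq0.
have [c c0 Ec] := nonconstant_vecP d0 ncon.
elim: n => [|n IHn]; first by rewrite expo_init expr0 mulr1 natr1 subrr mul0r subr0.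
rewrite (expo_sym p_pr p_odd E0 bS Ed n (symmetric_vecP sym) c0 Ec) natrM expo_pred IHn exprS.
by move: (P ^+ n) (t%:R : R) (P) P1 => y u z z1; field.
Qed.

(** The order that the recurrence gives at level 2 also shows that t = p. *)
Lemma constant_order n : constant_vec e ->
  (x n)%:R = t%:R * P ^+ n + 1 - (P ^+ n - 1) / (P - 1)
    - (P ^+ n - n%:R * P + n%:R - 1) / (P - 1) ^+ 2.
Proof.
move=> con; have [d d0 Ed] := nonzero_vecP e_neq0.
pose k := (E d)^-1; have k0 : k != 0 by rewrite invr_eq0.
have b'S m := bpowS p_pr m Ed erefl (constant_vecP d0 con).
have xk m : x m = (kexpo (bpow e k) m.+1).+1.
  by rewrite -(bpow_expo p_pr e m k0) (expo_kexpo p_pr b'S).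
have kS m := kexpoS p_pr p_odd b'S m.
have k1 : kexpo (bpow e k) 1 = p.
  by have := kS 0%N; rewrite (kexpo0 p_pr b'S) muln1 addn1 => -[].
have tp : t = p by apply: succn_inj; rewrite -expo_init xk k1.
elim: n => [|n IHn].
  by rewrite xk k1 tp expr0 mulr1 subrr mul0r !subr0 mul0r subr0 addr0 subrr mul0r subr0 natr1.
have := congr1 (fun m => m%:R : R) (kS n.+1).
rewrite natrD -[(p * _).+1%:R]natr1 natrM => e1.
have e2 : (x n.+1)%:R = (kexpo (bpow e k) n.+2)%:R + 1 :> R by rewrite xk natr1.
have e3 : (kexpo (bpow e k) n.+1)%:R = (x n)%:R - 1 :> R by rewrite xk -natr1 addrK.
move: e1; rewrite e3 IHn tp => e1.
have -> : (x n.+1)%:R = P * (P * P ^+ n + 1 - (P ^+ n - 1) / (P - 1)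
    - (P ^+ n - n%:R * P + n%:R - 1) / (P - 1) ^+ 2 - 1) + 1 - n.+2%:R + 1 :> R.
  by rewrite e2 -e1; ring.
rewrite [P ^+ n.+1]exprS -[n.+2%:R]natr1 -[n.+1%:R]natr1; by move: (P ^+ n) (n%:R : R) (P) P1 => y u z z1; field.
Qed.
End Orders.

Theorem theoremA (R : realType) (p : nat) (p_prime : prime p) (p_odd : odd p)
    (e : 'rV['F_p]_p.-1) (e_neq0 : e != 0) (n : nat) (n_ge2 : (2 <= n)%N) :
  let G_n := congruence_quotient (GGS e) n in
  let t := (\rank (circulant (append0 e)))%:R : R in
  let delta := (symmetric_vec e)%:R : R in
  let eps := (constant_vec e)%:R : R in
  finite_set G_n /\
  log p%:R (#|` fset_set G_n|)%fset%:R =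
    t * p%:R ^+ (n - 2) + 1
    - delta * ((p%:R ^+ (n - 2) - 1) / (p%:R - 1))
    - eps * ((p%:R ^+ (n - 2) - (n%:R - 2) * p%:R + n%:R - 3)
             / (p%:R - 1) ^+ 2).
Proof.
case: p p_prime p_odd e e_neq0 => [|[|q]] // p_pr p_odd e e_neq0 G_n t delta eps.
split; first exact: finite_congruence_quotient.
rewrite card_congruence_quotient; case: n n_ge2 @G_n => [|[|n]] // _ _.
rewrite log_order // !subSS subn0.
have -> : n.+2%:R - 2 = n%:R :> R by rewrite -addn2 natrD addrK.
have -> : q.+2%:R ^+ n - n%:R * q.+2%:R + n.+2%:R - 3 =
    q.+2%:R ^+ n - n%:R * q.+2%:R + n%:R - 1 :> R.
  by rewrite -[n.+2%:R]natr1 -[n.+1%:R]natr1; move: (n%:R : R) ((q.+2%:R : R) ^+ n) (q.+2%:R : R) => w u v; ring.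
rewrite /delta /eps /t; case: (boolP (constant_vec e)) => con.
  by rewrite (constant_order R) // (constant_vec_sym con) !mul1r.
case: (boolP (symmetric_vec e)) => sym.
  by rewrite (symmetric_order R) // mul1r mul0r subr0.
by rewrite (asymmetric_order R) // !mul0r !subr0.
Qed.
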